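(* Let $1\le d\le D$, let $U:\mathbb R^d\to[-\infty,\infty)$ be a (Borel measurable) utility function supported on $\mathbb R_+^d$, let $\tilde U$ be its extension to $\mathbb R^D$, and let $u(x)=\sup\{\mathrm E[\tilde U(X)]:X\in\mathcal A_T^x\}$, $x\in\mathbb R^D$, be the value function. Suppose that $u(x_0)<\infty$ for some $x_0\in\operatorname{int}(\operatorname{dom}(u))$. If either $U$ is bounded from above, or the dual function $U^*$ satisfies the growth condition, i.e. there exists a function $\zeta:(0,1]\to[0,\infty)$ such that for all $\epsilon\in(0,1]$ and all $x^*\in\operatorname{int}(\mathbb R_+^d)$ $$U^*(\epsilon x^* )\le\zeta(\epsilon)\big(U^*(x^* )^++1\big),$$ then both $U$ and the value function $u$ are asymptotically satiable.
   Context: Utility functions. For concave $f:\mathbb R^n\to[-\infty,\infty]$: $\operatorname{dom}(f)=\{f>-\infty\}$; $f$ is proper concave if $\operatorname{dom}(f)\neq\emptyset$ and $f<\infty$ everywhere; $\operatorname{cl}(f)$ is the function whose hypograph is the closure of the hypograph of $f$; $\partial f(x)=\{x^*: f(z)\le f(x)+\langle z-x,x^*\rangle\ \forall z\}$; the dual function is $f^*(x^* )=\sup_{x}\{f(x)-\langle x,x^*\rangle\}$. For a convex cone $C$ ($\lambda C+\mu C\subseteq C$ for $\lambda,\mu\ge0$), $x'\succeq_C x$ means $x'-x\in C$. A proper concave $f:\mathbb R^n\to[-\infty,\infty)$ is a utility function if $C_f:=\operatorname{cl}(\operatorname{dom}(f))$ is a convex cone with $\mathbb R_+^n\subseteq C_f\ne\mathbb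 R^n$ and $f$ is increasing with respect to $\succeq_{C_f}$; $f$ is then said to be supported on $C_f$. $f$ is asymptotically satiable if for all $\epsilon>0$ there is $x\in\mathbb R^n$ with $\partial(\operatorname{cl}(f))(x)\cap[0,\epsilon)^n\ne\emptyset$. Here $a^+=\max\{a,0\}$; the right-hand side of the growth inequality is read as $+\infty$ when $U^*(x^* )=+\infty$. The extension is $\tilde U(x)=U(x_1,\dots,x_d)$ for $x\in\mathbb R_+^D$ and $\tilde U(x)=-\infty$ otherwise. Market. A $D\times D$ matrix $\Pi=(\pi^{ij})$ is a bid-ask matrix if $\pi^{ij}>0$, $\pi^{ii}=1$ and $\pi^{ij}\le\pi^{ik}\pi^{kj}$ for all $i,j,k$. Its solvency cone $K(\Pi)\subseteq\mathbb R^D$ is the convex cone generated by the canonical basis vectors $e^i$ and the vectors $\pi^{ij}e^i-e^j$; $K^*(\Pi)=\{w\in\mathbb R^D:\langle v,w\rangle\ge0\ \forall v\in K(\Pi)\}$. Let $(\Omega,(\mathcal F_t)_{t\in[0,T]},\mathbb P)$ be a filtered probability space satisfying the usual conditions, and $(\Pi_t)_{t\in[0,T]}$ a fixed adapted càdlàg process with values in the bid-ask matrices; write $K_\tau=K(\Pi_\tau)$, $K_{\tau-}=K(\Pi_{\tau-})$, and similarly $K_\tau^*,K_{\tau-}^*$. Standing assumptions: $\mathcal F_{T-}=\mathcal F_T$ and $\Pi_{T-}=\Pi_T$ a.s., and $\mathcal Z^s\ne\emptyset$ ($\mathcal Z^s$ defined next). A consistent price process is an adapted $\mathbb R_+^D\setminus\{0\}$-valued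 càdlàg martingale $Z$ with $Z_t\in K_t^*$ a.s. for all $t\in[0,T]$; it is strictly consistent if moreover $Z_\tau\in\operatorname{int}(K_\tau^* )$ a.s. on $\{\tau<\infty\}$ for every $[0,T]\cup\{\infty\}$-valued stopping time $\tau$ and $Z_{\sigma-}\in\operatorname{int}(K_{\sigma-}^* )$ a.s. on $\{\sigma<\infty\}$ for every predictable $[0,T]\cup\{\infty\}$-valued stopping time $\sigma$. $\mathcal Z^s$ is the set of strictly consistent price processes. A self-financing portfolio process is an $\mathbb R^D$-valued predictable process $V=(V_t)_{t\in[0,T]}$ with a.e. path of finite variation (not necessarily right-continuous) such that for all stopping times $0\le\sigma\le\tau\le T$, $V_\tau-V_\sigma\in-\overline{\operatorname{conv}}(\bigcup_{\sigma\le t<\tau}K_t,0)$ a.s. (pathwise closed convex hull of the union together with $0$). It is admissible if there is $a>0$ such that $V_T+a\mathbf 1\in K_T$ a.s. and $\langle V_\tau+a\mathbf 1,Z_\tau^s\rangle\ge0$ a.s. for all $[0,T]$-valued stopping times $\tau$ and all $Z^s\in\mathcal Z^s$, where $\mathbf 1=(1,\dots,1)$. $\mathcal A^x$ is the set of admissible self-financing portfolio processes with $V_0=x$, and $\mathcal A_T^x=\{V_T:V\in\mathcal A^x\}$. Convention: $\mathrm E[\tilde U(X)]=-\infty$ whenever $\mathrm E[\tilde U(X)^-]=\infty$. *)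

(* Defs.v *)
From HB Require Import structures.
From mathcomp Require Import all_boot all_order all_algebra.
From mathcomp Require Import all_classical all_reals all_analysis.

Set Implicit Arguments.
Unset Strict Implicit.
Unset Printing Implicit Defensive.

Import Order.TTheory GRing.Theory Num.Theory.
Import numFieldNormedType.Exports.

Local Open Scope classical_set_scope.
Local Open Scope ring_scope.

Definition borel (E : topologicalType) : set (set E) := <<s @open E >>.

(* G is a sigma-algebra on S; the target carries its Borel sigma-algebra. *)
Definition borel_measurable_wrt (S : Type) (E : topologicalType)
    (G : set (set S)) (X : S -> E) : Prop :=
  forall B, borel B -> G (X @^-1` B).

Section ConvexAnalysis.
Context {R : realType} {n : nat}.
Implicit Types (x y z w : 'rV[R]_n) (C : set 'rV[R]_n) (f : 'rV[R]_n -> \bar R).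

Definition dotv x y : R := \sum_(i < n) x 0 i * y 0 i.

Definition orthant : set 'rV[R]_n := [set x | forall i, 0 <= x 0 i].

Definition convex_cone C : Prop :=
  forall (l m : R) x y, 0 <= l -> 0 <= m -> C x -> C y -> C (l *: x + m *: y).

Definition dual_cone C : set 'rV[R]_n :=
  [set w | forall v, C v -> 0 <= dotv v w].

Definition closed_convex_hull C : set 'rV[R]_n :=
  closure (smallest (fun A => convex_set (A : set (convex_lmodType 'rV[R]_n))) C).

(* R^o is R seen as a module over itself. *)
Definition hypograph f : set ('rV[R]_n * R^o)%type :=
  [set p | (p.2%:E <= f p.1)%E].

Definition concave f : Prop :=
  convex_set (hypograph f : set (convex_lmodType ('rV[R]_n * R^o)%type)).

Definition dom f : set 'rV[R]_n := [set x | (-oo < f x)%E].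

Definition proper_concave f : Prop :=
  [/\ concave f, dom f !=set0 & forall x, (f x < +oo)%E].

(* The vertical sections of the closure of a hypograph are closed and downward
   closed, so that closure is the hypograph of the supremum of its sections. *)
Definition cl f : 'rV[R]_n -> \bar R :=
  fun x => ereal_sup [set r%:E | r in [set r : R | closure (hypograph f) (x, r)]].

Definition superdifferential f x : set 'rV[R]_n :=
  [set xs | forall z, (f z <= f x + (dotv (z - x) xs)%:E)%E].

Definition dual_function f : 'rV[R]_n -> \bar R :=
  fun xs => ereal_sup (range (fun x => f x - (dotv x xs)%:E)%E).

Definition cone_increasing C f : Prop :=
  forall x x', C (x' - x) -> (f x <= f x')%E.

Definition support_cone f : set 'rV[R]_n := closure (dom f).

Definition utility_function f : Prop :=
  [/\ proper_concave f, convex_cone (support_cone f),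
      orthant `<=` support_cone f, support_cone f <> setT
    & cone_increasing (support_cone f) f].

Definition supported_on f C : Prop := support_cone f = C.

Definition asymptotically_satiable f : Prop :=
  forall eps : R, 0 < eps ->
    exists x, (superdifferential (cl f) x
               `&` [set xs | forall i, 0 <= xs 0 i < eps]) !=set0.

Definition bounded_above f : Prop := exists M : R, forall x, (f x <= M%:E)%E.

(* The premise on the dual function at xs encodes that the right-hand side is
   +oo when that value is +oo; a bare product would be 0 when zeta eps = 0. *)
Definition dual_growth_condition f : Prop :=
  exists zeta : R -> R,
    (forall eps, 0 < eps <= 1 -> 0 <= zeta eps) /\
    forall eps xs, 0 < eps <= 1 -> interior orthant xs ->
      (dual_function f xs < +oo ->
       dual_function f (eps *: xs)
         <= (zeta eps)%:E * (maxe (dual_function f xs) 0 + 1))%E.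

End ConvexAnalysis.

Definition utility_extension (R : realType) (d D : nat) (hdD : (d <= D)%N)
    (U : 'rV[R]_d -> \bar R) : 'rV[R]_D -> \bar R :=
  fun x => if `[< orthant x >] then U (\row_(i < d) x 0 (widen_ord hdD i))
           else -oo%E.

Section BidAsk.
Context {R : realType} {D : nat}.
Implicit Type Pi : 'M[R]_D.

Definition bid_ask_matrix Pi : Prop :=
  [/\ forall i j, 0 < Pi i j, forall i, Pi i i = 1
    & forall i j k, Pi i j <= Pi i k * Pi k j].

Definition basis_vector (i : 'I_D) : 'rV[R]_D := delta_mx 0 i.

Definition solvency_cone Pi : set 'rV[R]_D :=
  smallest convex_cone
    (range basis_vector `|`
     [set v | exists i j, v = Pi i j *: basis_vector i - basis_vector j]).

Definition dual_solvency_cone Pi : set 'rV[R]_D := dual_cone (solvency_cone Pi).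

End BidAsk.

(* Processes and filtrations are indexed by all of R, but only their values at
   times in [0, T] are ever used. *)
Section Processes.
Context {R : realType} {disp : measure_display} {Omega : measurableType disp}.
Variables (P : probability Omega R) (T : R) (F : R -> set (set Omega)).

Definition filtration : Prop :=
  [/\ forall t, 0 <= t <= T -> sigma_algebra setT (F t),
      forall t, 0 <= t <= T -> F t `<=` measurable
    & forall s t, 0 <= s -> s <= t -> t <= T -> F s `<=` F t].

Definition usual_conditions : Prop :=
  P.-negligible `<=` F 0 /\
  forall t, 0 <= t < T -> F t = \bigcap_(s in `]t, T]) F s.

Definition left_sigma_algebra (t : R) : set (set Omega) :=
  <<s \bigcup_(s in `[0, t[) F s >>.

Definition adapted (E : topologicalType) (X : R -> Omega -> E) : Prop :=
  forall t, 0 <= t <= T -> borel_measurable_wrt (F t) (X t).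

Definition cadlag (E : topologicalType) (X : R -> Omega -> E) : Prop :=
  forall w,
    (forall t, 0 <= t < T -> X s w @[s --> t^'+] --> X t w) /\
    (forall t, 0 < t <= T -> exists l : E, X s w @[s --> t^'-] --> l).

(* X_{t-}, with the usual convention X_{0-} = X_0. *)
Definition left_limit (E : ptopologicalType) (X : R -> Omega -> E)
    (t : R) (w : Omega) : E :=
  if t == 0 then X 0 w else lim (X s w @[s --> t^'-]).

Definition stopping_time (tau : Omega -> \bar R) : Prop :=
  (forall w, tau w = +oo%E \/ exists2 t, 0 <= t <= T & tau w = t%:E) /\
  forall t, 0 <= t <= T -> F t [set w | (tau w <= t%:E)%E].

Definition bounded_stopping_time (tau : Omega -> R) : Prop :=
  stopping_time (EFin \o tau).

Definition predictable_sets : set (set (R * Omega)) :=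
  <<s `[0, T] `*` setT,
      [set S | exists2 A, F 0 A & S = [set 0] `*` A] `|`
      [set S | exists s t A, [/\ 0 <= s, s < t, t <= T, F s A
                               & S = `]s, t] `*` A]] >>.

Definition predictable_process (E : topologicalType) (X : R -> Omega -> E) :
    Prop :=
  forall B, borel B ->
    predictable_sets [set p | 0 <= p.1 <= T /\ B (X p.1 p.2)].

Definition predictable_stopping_time (sigma : Omega -> \bar R) : Prop :=
  stopping_time sigma /\
  predictable_sets [set p | 0 <= p.1 <= T /\ (sigma p.2 <= p.1%:E)%E].

Definition martingale (n : nat) (Z : R -> Omega -> 'rV[R]_n) : Prop :=
  [/\ adapted Z,
      forall t i, 0 <= t <= T ->
        P.-integrable setT (fun w => (Z t w 0 i)%:E)
    & forall s t i A, 0 <= s -> s <= t -> t <= T -> F s A ->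
        (\int[P]_(w in A) (Z t w 0 i)%:E = \int[P]_(w in A) (Z s w 0 i)%:E)%E].

End Processes.

Section Market.
Context {R : realType} {disp : measure_display} {Omega : measurableType disp}.
Context {D : nat}.
Variables (P : probability Omega R) (T : R) (F : R -> set (set Omega)).
Variable Pi : R -> Omega -> 'M[R]_D.
Implicit Types (Z V : R -> Omega -> 'rV[R]_D).

Definition consistent_price_process Z : Prop :=
  [/\ forall t w, 0 <= t <= T -> orthant (Z t w) /\ Z t w <> 0,
      cadlag T Z, martingale P T F Z
    & forall t, 0 <= t <= T ->
        {ae P, forall w, dual_solvency_cone (Pi t w) (Z t w)}].

Definition strictly_consistent_price_process Z : Prop :=
  [/\ consistent_price_process Z,
      forall tau, stopping_time T F tau ->
        {ae P, forall w, (tau w < +oo)%E ->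
          interior (dual_solvency_cone (Pi (fine (tau w)) w))
                   (Z (fine (tau w)) w)}
    & forall sigma, predictable_stopping_time T F sigma ->
        {ae P, forall w, (sigma w < +oo)%E ->
          interior (dual_solvency_cone (left_limit Pi (fine (sigma w)) w))
                   (left_limit Z (fine (sigma w)) w)}].

Definition self_financing V : Prop :=
  [/\ predictable_process T F V,
      {ae P, forall w, forall i, bounded_variation 0 T (fun t => V t w 0 i)}
    & forall sigma tau,
        bounded_stopping_time T F sigma -> bounded_stopping_time T F tau ->
        (forall w, sigma w <= tau w) ->
        {ae P, forall w,
          [set - v | v in closed_convex_hull
             ((\bigcup_(t in `[sigma w, tau w[) solvency_cone (Pi t w))
              `|` [set 0])]
          (V (tau w) w - V (sigma w) w)}].

Definition admissible V : Prop :=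
  exists2 a : R, 0 < a &
    {ae P, forall w, solvency_cone (Pi T w) (V T w + const_mx a)} /\
    forall tau Z, bounded_stopping_time T F tau ->
      strictly_consistent_price_process Z ->
      {ae P, forall w, 0 <= dotv (V (tau w) w + const_mx a) (Z (tau w) w)}.

Definition admissible_portfolios (x : 'rV[R]_D) : set (R -> Omega -> 'rV[R]_D) :=
  [set V | [/\ self_financing V, admissible V & {ae P, forall w, V 0 w = x}]].

Definition terminal_values (x : 'rV[R]_D) : set (Omega -> 'rV[R]_D) :=
  [set V T | V in admissible_portfolios x].

End Market.

Definition expected_utility (R : realType) (disp : measure_display)
    (Omega : measurableType disp) (P : probability Omega R) (D : nat)
    (f : 'rV[R]_D -> \bar R) (X : Omega -> 'rV[R]_D) : \bar R :=
  (if \int[P]_w (f \o X)^\- w == +oo then -oo else \int[P]_w f (X w))%E.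

Definition value_function (R : realType) (disp : measure_display)
    (Omega : measurableType disp) (P : probability Omega R) (T : R)
    (F : R -> set (set Omega)) (D : nat) (Pi : R -> Omega -> 'M[R]_D)
    (f : 'rV[R]_D -> \bar R) : 'rV[R]_D -> \bar R :=
  fun x => ereal_sup [set expected_utility P f X | X in terminal_values P T F Pi x].

(* Main.v *)
(** The duality theorem for the market is not needed. If a concave increasing
function lies below [M + eps <x, q>] for every [eps > 0], then a quadratic
penalization turns the slope [eps q] into an exact supergradient of the closure
with small nonnegative entries. Both [U] and [u] have a supergradient at an
interior point of their domain, so it remains to scale its slope down (to [0] if
[U] is bounded above). In primal terms the growth condition on [U^*] says that
[l U(x) + k <= U(l eps x + 1)] for some [l > 0] and [k]. This inequality passes
to [u], because [l eps V + 1] is an admissible portfolio whenever [V] is; applying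
the affine bound to the right-hand side yields an affine bound of slope [eps q]. *)

Require Import Defs.
From mathcomp Require Import all_boot all_order all_algebra.
From mathcomp Require Import all_classical all_reals all_analysis.
From mathcomp Require Import measurable_realfun.
From mathcomp Require Import ring lra.

Set Implicit Arguments.
Unset Strict Implicit.
Unset Printing Implicit Defensive.

Import Order.TTheory GRing.Theory Num.Theory.
Import numFieldNormedType.Exports.

Local Open Scope classical_set_scope.
Local Open Scope ring_scope.

(** * Supergradients of concave functions at interior points of the domain *)

Section Supergradient.
Context {R : realType} {n : nat}.
Implicit Types (x y z v w : 'rV[R]_n) (f : 'rV[R]_n -> \bar R).

(** Three obstacles shape the proof. An affine bound need not touch the function: a bounded strictly
    increasing $U$ never attains its supremum, so slope $0$ is not a supergradient anywhere. The
    penalty $\delta|x|^2$ forces attainment; it adds the slope $2\delta x$ at the maximizer $x$, and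
    since $\delta|x|^2$ stays bounded as $\delta\to0$, this slope is of order $\sqrt\delta$. Next,
    no semicontinuity of $U$ or $u$ is known, and a priori $u$ may equal $+\infty$ away from $x_0$.
    Hence the maximum is taken over points (vector, height) of the closed hypograph, and
    supergradients are obtained from the finiteness of a single value. Finally, the supremum in $u$
    need not be attained and the positive parts of utilities need not be integrable. Concavity,
    monotonicity, growth and boundedness of $u$ therefore all rest on one inequality for
    expectations, which keeps positive and negative parts apart. *)

Lemma dotvDl x y z : dotv (x + y) z = dotv x z + dotv y z.
Proof. by rewrite -big_split/=; apply: eq_bigr => i _; rewrite mxE mulrDl. Qed.

Lemma dotvZl (a : R) x y : dotv (a *: x) y = a * dotv x y.
Proof. by rewrite mulr_sumr; apply: eq_bigr => i _; rewrite mxE mulrA. Qed.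

Lemma dotvC x y : dotv x y = dotv y x.
Proof. by apply: eq_bigr => i _; rewrite mulrC. Qed.

Lemma dotvDr x y z : dotv z (x + y) = dotv z x + dotv z y.
Proof. by rewrite !(dotvC z) dotvDl. Qed.

Lemma dotvZr (a : R) x y : dotv y (a *: x) = a * dotv y x.
Proof. by rewrite !(dotvC y) dotvZl. Qed.

Lemma dotvNl x y : dotv (- x) y = - dotv x y.
Proof. by rewrite -scaleN1r dotvZl mulN1r. Qed.

Lemma dotvBl x y z : dotv (x - y) z = dotv x z - dotv y z.
Proof. by rewrite dotvDl dotvNl. Qed.

Lemma dotv_basis i y : dotv (basis_vector i) y = y 0 i.
Proof.
rewrite /dotv (bigD1 i)//= big1 ?addr0 => [|j ji]; rewrite mxE eqxx/=.
  by rewrite eqxx mul1r.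
by rewrite (negPf ji) mul0r.
Qed.

Lemma row_basis_sum x : x = \sum_(i < n) x 0 i *: basis_vector i.
Proof. exact: row_sum_delta. Qed.

Lemma dotv_ge0 x y : orthant x -> orthant y -> 0 <= dotv x y.
Proof. by move=> x0 y0; apply: sumr_ge0 => i _; rewrite mulr_ge0. Qed.

Lemma dotvv_ge0 x : 0 <= dotv x x.
Proof. by apply: sumr_ge0 => i _; rewrite -expr2 sqr_ge0. Qed.

(* A convex cone in the graph space whose fibres over the vectors are nonempty
   and bounded above; its upper boundary is a finite superlinear function. *)
Record superlinear_cone (C : 'rV[R]_n -> R -> Prop) : Prop := {
  slc_add : forall v w s t, C v s -> C w t -> C (v + w) (s + t);
  slc_scale : forall v s c, 0 < c -> C v s -> C (c *: v) (c * s);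
  slc_fibre : forall v, exists s, C v s;
  slc_zero : forall s, C 0 s -> s <= 0 }.

Definition lineality (C : 'rV[R]_n -> R -> Prop) w (a : R) :=
  forall v s c, C v s -> C (v + c *: w) (s + c * a).

(** The extension step of Hahn-Banach in graph form: [C'] is the sum of [C] and the line through
    [(w, a)], with [a] the supremum of the fibre over [w]. The fibre over 0 stays nonpositive in
    both directions of the line: [a] is an upper bound, which settles [t > 0], and the least one,
    which settles [t < 0]. *)
Lemma superlinear_cone_add_line C w : superlinear_cone C ->
  exists C' a, [/\ superlinear_cone C', forall v s, C v s -> C' v s,
    lineality C' w a & forall u b, lineality C u b -> lineality C' u b].
Proof.
move=> [Cadd Cscale Cfib C0].
pose S := [set s | C w s]; pose a := sup S.
have supS : has_sup S.
  split; first exact: Cfib.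
  have [s0 s0P] := Cfib (- w); exists (- s0) => s sP.
  by rewrite -subr_le0 opprK; apply: C0; rewrite -(subrr w); apply: Cadd.
exists (fun v s => exists t, C (v + t *: w) (s + t * a)), a; split.
- split.
  + move=> v u s r [t tP] [q qP]; exists (t + q).
    have := Cadd _ _ _ _ tP qP; rewrite scalerDl mulrDl.
    by rewrite -!addrA [in t *: w + _]addrCA [in t * a + _]addrCA.
  + move=> v s c c0 [t tP]; exists (c * t).
    by have := Cscale _ _ _ c0 tP; rewrite scalerDr mulrDr scalerA mulrA.
  + by move=> v; have [s sP] := Cfib v; exists s, 0; rewrite scale0r mul0r !addr0.
  + move=> s [t]; rewrite add0r; case: (ltgtP t 0) => [t0|t0|->].
    * move=> sP; rewrite -(@pmulr_rle0 _ (- t)^-1) ?invr_gt0 ?oppr_gt0//.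
      set s' := _ * _.
      have {}sP : C (- w) (s' - a).
        have := Cscale _ _ (- t)^-1 _ sP; rewrite invr_gt0 oppr_gt0 => /(_ t0).
        rewrite scalerA mulrDr mulrA invrN mulNr mulVf ?lt_eqF//.
        by rewrite scaleN1r mulN1r /s' invrN.
      suff : a <= a - s' by lra.
      apply: sup_le_ub; first by case: supS.
      move=> r rP; have := Cadd _ _ _ _ rP sP; rewrite subrr => /C0; lra.
    * move=> sP; rewrite -(@pmulr_rle0 _ t^-1) ?invr_gt0//.
      suff : t^-1 * s + a <= a by rewrite gerDr.
      apply: sup_upper_bound => //; rewrite /S/=.
      have := Cscale _ _ t^-1 _ sP; rewrite invr_gt0 => /(_ t0).
      by rewrite scalerA mulVf ?gt_eqF// scale1r mulrDr mulKf ?gt_eqF.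
    * by rewrite scale0r mul0r addr0 => /C0.
- by move=> v s vs; exists 0; rewrite scale0r mul0r !addr0.
- move=> v s c [t tP]; exists (t - c).
  by rewrite -!addrA -scalerDl -mulrDl addrCA subrr addr0.
- move=> u b ub v s c [t tP]; exists t.
  by rewrite addrAC [s + _ + _]addrAC; apply: ub.
Qed.

(** Once the cone contains a line [(e_i, q_i)] for every basis vector, these lines carry [(v, s)] to
    [(0, s - <v, q>)], where the height is known to be nonpositive. *)
Lemma superlinear_cone_minorant C : superlinear_cone C ->
  exists q, forall v s, C v s -> s <= dotv v q.
Proof.
move=> slcC.
have [C' [q [slcC' CC' lin]]] : exists C' (q : 'I_n -> R),
    [/\ superlinear_cone C', forall v s, C v s -> C' v s
      & forall i, i \in enum 'I_n -> lineality C' (basis_vector i) (q i)].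
  elim: (enum 'I_n) => [|j l [C1 [q [slc1 CC1 lin1]]]].
    by exists C, (fun=> 0).
  have [C2 [a [slc2 CC2 lin2 keep]]] :=
    superlinear_cone_add_line (basis_vector j) slc1.
  exists C2, (fun i => if i == j then a else q i); split=> //.
    by move=> v s /CC1/CC2.
  move=> i; rewrite inE; case: eqP => [-> _//|_ /= il].
  exact/keep/lin1.
have {}lin : forall i, lineality C' (basis_vector i) (q i).
  by move=> i; apply: lin; rewrite mem_enum.
exists (\row_i q i) => v s /CC' vs.
have : C' (v + \sum_i (- v 0 i) *: basis_vector i) (s + \sum_i (- v 0 i) * q i).
  pose K u b := forall x r, C' x r -> C' (x + u) (r + b).
  apply: (big_ind2 K) vs => [u r|u b x c ub xc y r yr|i _ u r ur].
  - by rewrite !addr0.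
  - by rewrite !addrA; apply/xc/ub.
  - exact: lin.
rewrite [X in v + X](_ : _ = - v); last first.
  rewrite {2}[v]row_basis_sum raddf_sum.
  by apply: eq_bigr => i _; rewrite scaleNr.
rewrite subrr => /(slc_zero slcC').
rewrite [X in s + X](_ : _ = - dotv v (\row_i q i)) ?subr_le0//.
rewrite /dotv raddf_sum; apply: eq_bigr => i _.
by rewrite mulNr mxE.
Qed.

Lemma concaveP f : concave f -> forall (t : R) x y r s, 0 <= t <= 1 ->
  (r%:E <= f x)%E -> (s%:E <= f y)%E ->
  ((t * r + (1 - t) * s)%R%:E <= f (t *: x + (1 - t) *: y)%R)%E.
Proof.
move=> cf t x y r s /andP[t0 t1] rx sy.
have := cf (x, r) (y, s) (Itv01 t0 t1); rewrite !inE; exact.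
Qed.

Lemma convex_setP (E : lmodType R) (A : set E) :
  (forall (t : R) (x y : E), 0 <= t <= 1 -> A x -> A y ->
    A (t *: x + (1 - t) *: y)) -> convex_set (A : set (convex_lmodType E)).
Proof.
move=> h x y l; rewrite !inE => Ax Ay; apply: h => //.
by rewrite ge0 le1.
Qed.

Lemma interior_ray (A : set 'rV[R]_n) z v : interior A z ->
  exists2 t : R, 0 < t & A (z + t *: v).
Proof.
move=> /nbhs_ballP[e/= e0 eA].
pose M := `|v| + 1; have M0 : 0 < M by rewrite ltr_wpDl.
exists (e / M); first by rewrite divr_gt0.
apply: eA; rewrite -ball_normE/= opprD addrA subrr add0r normrN normrZ.
rewrite ger0_norm ?divr_ge0 ?ltW// -mulrA gtr_pMr// ltr_pdivrMl// mulr1.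
by rewrite ltrDl.
Qed.

(** The cone [C] is generated by the hypograph of [f], translated so that [(z, f z)] becomes the
    origin; its heights are difference quotients. That [z] is interior gives every direction a
    nonempty fibre, and the finite value at [z] bounds the fibre over 0. A supergradient then
    excludes the value [+oo] everywhere else. *)
Lemma supergradient_exists f z : concave f -> interior (dom f) z ->
  (f z < +oo)%E -> exists q, superdifferential f z q.
Proof.
move=> cf iz fzoo; have fz : (-oo < f z)%E by exact: interior_subset iz.
have [a fza] : exists a, f z = a%:E.
  by case: (f z) fz fzoo => // r _ _; exists r.
pose C v s := exists t r, [/\ 0 < t, (r%:E <= f (z + t *: v)%R)%E & s = (r - a) / t].
have Cadd v w s t : C v s -> C w t -> C (v + w) (s + t).
  move=> [t1 [r1 [t10 r1P ->]]] [t2 [r2 [t20 r2P ->]]].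
  have t120 : 0 < t1 + t2 by rewrite addr_gt0.
  (* The weight for which the steps [l * t1] and [(1 - l) * t2] coincide, so that the convex
     combination lies on the ray from [z] in direction [v + w]. *)
  pose l := t2 / (t1 + t2).
  have lE : 1 - l = t1 / (t1 + t2) by rewrite /l; field; rewrite gt_eqF.
  exists (l * t1), (l * r1 + (1 - l) * r2); split.
  - by rewrite !mulr_gt0 ?invr_gt0.
  - have := concaveP cf _ r1P r2P; rewrite -/l => /(_ l) le.
    have {}le : ((l * r1 + (1 - l) * r2)%R%:E
        <= f (l *: (z + t1 *: v) + (1 - l) *: (z + t2 *: w))%R)%E.
      by apply: le; apply/andP; rewrite /l ler_pdivrMr ?mul1r ?lerDr ?divr_ge0 ?ltW.
    apply: (le_trans le); rewrite le_eqVlt; apply/orP; left; apply/eqP.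
    congr f; apply/rowP => i; rewrite !mxE.
    have lt : (1 - l) * t2 = l * t1 by rewrite lE /l; ring.
    by rewrite mulrDr [(1 - l) * _]mulrDr [(1 - l) * (t2 * _)]mulrA lt; ring.
  - rewrite lE /l; field; rewrite !gt_eqF//=; lra.
have slc : superlinear_cone C.
  split => //.
  - move=> v s c c0 [t [r [t0 rP ->]]]; exists (t / c), r; split.
    + by rewrite divr_gt0.
    + by rewrite scalerA divfK ?gt_eqF.
    + by field; rewrite !gt_eqF.
  - move=> v; have [t t0 tP] := interior_ray v iz.
    have [r rP] : exists r : R, (r%:E <= f (z + t *: v)%R)%E.
      move: tP; rewrite /dom/=; case: (f _) => [r| |]//= _;
        last by exists 0; rewrite leey.
      by exists r.
    by exists ((r - a) / t), t, r.
  - move=> s [t [r [t0 rP ->]]]; rewrite scaler0 addr0 fza lee_fin in rP.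
    by rewrite pmulr_lle0 ?invr_gt0// subr_le0.
have [q qP] := superlinear_cone_minorant slc.
exists q => y; rewrite fza.
suff h : forall r : R, (r%:E <= f y)%E -> r <= a + dotv (y - z) q.
  case: (f y) h => [r| |] h.
  - by rewrite -EFinD lee_fin; exact: h.
  - by have := h (a + dotv (y - z) q + 1) (leey _); rewrite gerDl ler10.
  - by rewrite leNye.
move=> r rP; rewrite -lerBlDl; apply: qP; exists 1, r; split=> //.
  by rewrite scale1r addrC subrK.
by rewrite divr1.
Qed.

End Supergradient.

(** * Closures under continuous maps and linear combinations *)

Section Closures.

Lemma closure_image2 (T U V : topologicalType) (g : T * U -> V) (A : set T)
    (B : set U) (C : set V) x y :
  continuous g -> (forall a b, A a -> B b -> C (g (a, b))) ->
  closure A x -> closure B y -> closure C (g (x, y)).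
Proof.
move=> gc gC Ax By N /gc[[P Q]/= [Px Qy] PQN].
have [a [Aa Pa]] := Ax _ Px; have [b [Bb Qb]] := By _ Qy.
by exists (g (a, b)); split; [exact: gC|exact: (PQN (a, b))].
Qed.

Lemma closure_image (T V : topologicalType) (g : T -> V) (A : set T)
    (C : set V) x :
  continuous g -> (forall a, A a -> C (g a)) -> closure A x -> closure C (g x).
Proof.
by move=> gc gC Ax N /gc /Ax[a [Aa Na]]; exists (g a); split=> //; exact: gC.
Qed.

Lemma closure_combination (R : realType) (E : normedModType R) (A : set E)
    (a b : R) :
  (forall x y, A x -> A y -> A (a *: x + b *: y)) ->
  forall x y, closure A x -> closure A y -> closure A (a *: x + b *: y).
Proof.
move=> h x y Ax Ay.
have gc : continuous (fun p : E * E => a *: p.1 + b *: p.2).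
  by move=> p; apply: cvgD;
    [apply: cvgZr; exact: cvg_fst|apply: cvgZr; exact: cvg_snd].
by apply: (closure_image2 gc) Ax Ay => u v; exact: h.
Qed.

End Closures.

(** * From affine bounds to exact supergradients of the closure *)

Section Satiability.
Context {R : realType} {n : nat}.
Implicit Types (x y z v w p : 'rV[R]_n) (f : 'rV[R]_n -> \bar R).

Lemma dotv_continuous (T : topologicalType) (g h : T -> 'rV[R]_n) :
  continuous g -> continuous h -> continuous (fun t => dotv (g t) (h t)).
Proof.
move=> gc hc; apply: continuous_big => [|i _ t].
  exact: add_continuous.
by apply: cvgM; apply: (cvg_comp _ _ (gc t) (@coord_continuous _ _ _ _ _ _))
  || apply: (cvg_comp _ _ (hc t) (@coord_continuous _ _ _ _ _ _)).
Qed.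

Lemma orthant_basis i : orthant (basis_vector i : 'rV[R]_n).
Proof. by move=> j; rewrite mxE ler0n. Qed.

Lemma sqr_le_dotv x i : x 0 i ^+ 2 <= dotv x x.
Proof.
rewrite /dotv (bigD1 i)//= -expr2 lerDl.
by apply: sumr_ge0 => j _; rewrite -expr2 sqr_ge0.
Qed.

Section Hypograph.
Variable f : 'rV[R]_n -> \bar R.
Hypothesis cf : concave f.
Hypothesis incf : cone_increasing orthant f.
Let H := closure (hypograph f).

Lemma closure_hypograph_convex (t : R) x y r s : 0 <= t <= 1 ->
  H (x, r) -> H (y, s) -> H (t *: x + (1 - t) *: y, t * r + (1 - t) * s).
Proof.
move=> t01 xr ys.
apply: (closure_combination _ xr ys) => -[x' r'] [y' s'] rx sy.
exact: concaveP.
Qed.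

Lemma closure_hypograph_increasing x v r : orthant v ->
  H (x, r) -> H (x + v, r).
Proof.
move=> v0; apply: (closure_image (g := fun q : 'rV[R]_n * R^o => (q.1 + v, q.2))).
  move=> q; apply: (@cvg_pair _ _ _ _ (nbhs (q.1 + v)) (nbhs q.2)).
    by apply: cvgD; [exact: cvg_fst|exact: cvg_cst].
  exact: cvg_snd.
move=> [x' r'] /= r'x'; apply: (le_trans r'x'); apply: incf.
by rewrite addrAC subrr add0r.
Qed.

Lemma closure_hypograph_affine M p : (forall x, f x <= (M + dotv x p)%:E)%E ->
  forall x r, H (x, r) -> r <= M + dotv x p.
Proof.
move=> fM x r xr; rewrite -lerBlDr.
suff : closure [set s : R | s <= M] (r - dotv x p).
  by rewrite -((closure_id _).1 (@closed_le _ M)).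
apply: (closure_image (g := fun q : 'rV[R]_n * R^o => (q.2 - dotv q.1 p : R)) _ _ xr).
  move=> q; apply: cvgB; first exact: cvg_snd.
  by apply: dotv_continuous => // q'; [exact: cvg_fst|exact: cvg_cst].
move=> [x' r'] /= r'x'; rewrite lerBlDr -lee_fin.
exact: le_trans r'x' (fM x').
Qed.

Lemma cl_closure_hypograph x (r : R) : H (x, r) ->
  (forall s, H (x, s) -> s <= r) -> cl f x = r%:E.
Proof.
move=> xr max; apply/eqP; rewrite eq_le; apply/andP; split.
  by apply: ge_ereal_sup => _ [s xs <-]; rewrite lee_fin; exact: max.
by apply: ereal_sup_ubound; exists r.
Qed.

(** On the closed hypograph the affine bound leaves at most [M - delta |y|^2] for the penalized
    height. The superlevel set through [(x0, r0)] is thus bounded in the vector, hence also in the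
    height, and compactness gives a maximizer. *)
Lemma penalized_maximum M p x0 (r0 delta : R) : 0 < delta ->
  (forall x, f x <= (M + dotv x p)%:E)%E -> (r0%:E <= f x0)%E ->
  exists x (r : R), H (x, r) /\ forall y s, H (y, s) ->
    s - dotv y p - delta * dotv y y <= r - dotv x p - delta * dotv x x.
Proof.
move=> d0 fM fx0.
pose phi (q : 'rV[R]_n * R^o) : R := q.2 - dotv q.1 p - delta * dotv q.1 q.1.
have phic : continuous phi.
  have c1 : continuous (fun q : 'rV[R]_n * R^o => q.1) by move=> q; exact: cvg_fst.
  move=> q; apply: cvgB; [apply: cvgB|].
  - exact: cvg_snd.
  - by apply: dotv_continuous => // q'; exact: cvg_cst.
  - by apply: cvgM; [exact: cvg_cst|exact: dotv_continuous].
have H0 : H (x0, r0) by exact: subset_closure.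
pose K := H `&` [set q | phi (x0, r0) <= phi q].
have K0 : K (x0, r0) by split=> //=; exact: lexx.
have clK : closed K.
  apply: closedI; first exact: closed_closure.
  apply: (preimage_closed (f := phi) (D := [set s : R | phi (x0, r0) <= s])).
    by move=> q _; exact: phic.
  exact: closed_ge.
pose N := M - phi (x0, r0).
have KN q : K q -> delta * dotv q.1 q.1 <= N.
  move=> [Hq]; rewrite /phi/= /N; case: q Hq => x r /= Hq.
  have := closure_hypograph_affine fM Hq; rewrite /phi/=; lra.
(* A coordinate [c] satisfies [c ^+ 2 <= N / delta], and [|c| <= 1 + c ^+ 2] avoids the square
   root. *)
pose b := 1 + N / delta.
have Kb q i : K q -> `|q.1 0 i| <= b.
  move=> /KN; rewrite mulrC -ler_pdivlMr// => qN.
  have := le_trans (sqr_le_dotv q.1 i) qN; rewrite -real_normK ?num_real// /b.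
  move: (`|_|) => c cN; have := sqr_ge0 (c - 1); have := sqr_ge0 c; lra.
pose B := b * \sum_(i < n) `|p 0 i|.
have KB q : K q -> `|dotv q.1 p| <= B.
  move=> Kq; apply: le_trans (ler_norm_sum _ _ _) _; rewrite /B mulr_sumr.
  by apply: ler_sum => i _; rewrite normrM ler_wpM2r// Kb.
have cK : compact K.
  apply: (@subclosed_compact _ K
      ([set v : 'rV[R]_n | forall i, `[- b, b]%classic (v ord0 i)]
      `*` `[phi (x0, r0) - B, M + B]%classic)) => //.
    apply: compact_setX; last exact: segment_compact.
    apply: (@rV_compact _ _ (fun=> `[- b, b]%classic)) => i.
    exact: segment_compact.
  move=> [x r] Kx; split=> /= [i|].
    by rewrite in_itv/= -ler_norml; exact: Kb Kx.
  rewrite in_itv/=; have := KB _ Kx; rewrite ler_norml => /= /andP[B1 B2].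
  case: Kx => Hx /=; rewrite {2}/phi/= => phix.
  have := closure_hypograph_affine fM Hx.
  have : 0 <= delta * dotv x x.
    by rewrite mulr_ge0 ?dotvv_ge0// ltW.
  by move: B1 B2 phix; move: (dotv x p) (delta * _) => ? ?; lra.
have phiK : {within K, continuous phi} by exact: continuous_subspaceT.
have [[x r] Kx xmax] := compact_EVT_max (ex_intro _ _ K0) cK phiK.
move: Kx; rewrite inE => Kx; exists x, r; split; first by case: Kx.
move=> y s Hy; have [Ky|] := leP (phi (x0, r0)) (phi (y, s)).
  by apply: (xmax (y, s)); rewrite inE.
by move=> /ltW /le_trans; apply; case: Kx.
Qed.

(** The first-order condition at the maximizer, [2 delta x] being the gradient of the penalty. The
    maximum is compared with the point at parameter [t] on the segment to [(y, s)]; after division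
    by [t] the error is [t delta |y - x|^2]. *)
Lemma penalized_supergradient x p (r delta : R) : 0 < delta -> H (x, r) ->
  (forall y s, H (y, s) ->
    s - dotv y p - delta * dotv y y <= r - dotv x p - delta * dotv x x) ->
  forall y s, H (y, s) -> s <= r + dotv (y - x) (p + (2 * delta) *: x).
Proof.
move=> d0 Hx xmax y s Hy.
apply/ler_addgt0Pr => e e0.
pose a := dotv (y - x) (y - x).
have a0 : 0 <= a by exact: dotvv_ge0.
(* Lies in []0, 1]] and keeps the quadratic error [t * (delta * a)] below [e]. *)
pose t := e / (e + delta * a).
have da : 0 <= delta * a by rewrite mulr_ge0// ltW.
have t0 : 0 < t by rewrite divr_gt0// ltr_wpDr.
have t1 : t <= 1 by rewrite ler_pdivrMr ?ltr_wpDr// mul1r lerDl.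
have ta : t * (delta * a) <= e.
  rewrite /t mulrAC ler_pdivrMr ?ltr_wpDr// ler_pM2l// lerDr ltW//.
have t01 : 0 <= t <= 1 by rewrite t1 ltW.
rewrite -(ler_pM2l t0).
have : t * (t * (delta * a)) <= t * e by rewrite ler_pM2l.
have := xmax _ _ (closure_hypograph_convex t01 Hy Hx).
have -> : t *: y + (1 - t) *: x = x + t *: (y - x).
  by rewrite scalerBl scale1r scalerBr addrCA addrC.
rewrite /a; move: (y - x) => u.
rewrite !(dotvDr, dotvDl, dotvZl, dotvZr) (dotvC u x).
by move: (dotv u u) (dotv x u) (dotv x x) (dotv u p) (dotv x p) => A B D E G; lra.
Qed.

End Hypograph.

(* Maximize f - <., p> - delta |.|^2 over the closed hypograph: the slope of the
   penalty at the maximizer perturbs p into an exact supergradient. *)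
Lemma asymptotically_satiableP f : concave f -> cone_increasing orthant f ->
  dom f !=set0 ->
  (forall eps : R, 0 < eps -> exists p (M : R), (forall i, p 0 i < eps) /\
    forall x, (f x <= (M + dotv x p)%:E)%E) ->
  asymptotically_satiable f.
Proof.
move=> cf incf [x0 fx0] small eps eps0.
have [p [M [peps fM]]] := small _ (divr_gt0 eps0 (ltr0Sn R 1)).
have [r0 r0P] : exists r0 : R, (r0%:E <= f x0)%E.
  move: fx0; rewrite /dom/=; case: (f x0) => [r| |]//= _; first by exists r.
  by exists 0; rewrite leey.
pose N := M - r0 + dotv x0 p + dotv x0 x0.
have N0 : 0 <= N.
  have := le_trans r0P (fM x0); rewrite lee_fin /N.
  have := dotvv_ge0 x0.
  lra.
(* At the maximizer [delta |x|^2 <= N], where [N] does not depend on [delta] as long as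
   [delta <= 1]. So [(2 delta x_i)^2 <= 4 delta N], and [16 delta N < eps^2] puts [2 delta x_i]
   below [eps / 2]. *)
pose delta := eps ^+ 2 / (eps ^+ 2 + 16 * N + 16).
have e20 : 0 < eps ^+ 2 by rewrite exprn_gt0.
have den0 : 0 < eps ^+ 2 + 16 * N + 16 by lra.
have d0 : 0 < delta by rewrite divr_gt0.
have d1 : delta <= 1 by rewrite /delta ler_pdivrMr// mul1r; lra.
have dN : 16 * (delta * N) < eps ^+ 2.
  have -> : 16 * (delta * N) = eps ^+ 2 * (16 * N / (eps ^+ 2 + 16 * N + 16)).
    by rewrite /delta; field; rewrite gt_eqF.
  by rewrite gtr_pMr// ltr_pdivrMr// mul1r; lra.
have [x [r [Hx xmax]]] := penalized_maximum d0 fM r0P.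
have sup := penalized_supergradient cf d0 Hx xmax.
have clx : cl f x = r%:E.
  by apply: cl_closure_hypograph => // s /sup; rewrite subrr /dotv big1 ?addr0// => i _;
    rewrite mxE mul0r.
exists x, (p + (2 * delta) *: x); split=> [z|i] /=.
  rewrite clx -EFinD; apply: ge_ereal_sup => _ [s zs <-].
  by rewrite lee_fin; exact: sup.
(* The entries of [p] are bounded only from above. Nonnegativity of the slope comes from
   monotonicity: a move along a basis vector keeps the height [r] in the closed hypograph. *)
apply/andP; split.
  have := sup _ _ (closure_hypograph_increasing incf (orthant_basis i) Hx).
  by rewrite addrAC subrr add0r dotv_basis lerDl.
have le1 : delta * dotv x x <= N.
  have H0 : closure (hypograph f) (x0, r0) by exact: subset_closure.
  have := xmax _ _ H0.
  have := closure_hypograph_affine fM Hx.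
  have : delta * dotv x0 x0 <= dotv x0 x0.
    by rewrite ler_piMl// dotvv_ge0.
  rewrite /N; lra.
have := sqr_le_dotv x i; have := peps i; rewrite !mxE.
move: (x 0 i) (p 0 i) => c b bP cP.
suff : 2 * delta * c < eps / 2 by lra.
have [c0|c0] := leP c 0.
  by have : delta * c <= 0 by [rewrite pmulr_rle0]; lra.
have dc0 : 0 <= 2 * delta * c by rewrite !pmulr_lge0 ?ltW.
rewrite -ltr_sqr ?nnegrE ?divr_ge0 ?(ltW eps0)//.
have : delta * c ^+ 2 <= N by apply: le_trans le1; rewrite ler_pM2l.
move=> dcN; have : delta * (delta * c ^+ 2) <= delta * N by rewrite ler_pM2l.
have -> : (2 * delta * c) ^+ 2 = 4 * (delta * (delta * c ^+ 2)) by ring.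
have -> : (eps / 2) ^+ 2 = eps ^+ 2 / 4 by field.
by lra.
Qed.

End Satiability.

(** * The growth condition in primal form and affine bounds of small slope *)

Section Growth.
Context {R : realType} {n : nat}.
Implicit Types (x y z q : 'rV[R]_n) (f U : 'rV[R]_n -> \bar R).

Lemma nbhs_coordinates (S : 'I_n -> set R) z :
  (forall i, nbhs (z 0 i) (S i)) -> nbhs z [set x : 'rV[R]_n | forall i, S i (x 0 i)].
Proof.
by move=> Sz; exists (fun _ j => S j) => [i j|x Sx i]; [rewrite ord1|exact: Sx].
Qed.

Lemma interior_pos (A : set 'rV[R]_n) z : (forall i, 0 < z 0 i) ->
  [set x : 'rV[R]_n | forall i, 0 < x 0 i] `<=` A -> interior A z.
Proof.
move=> z0 h; apply: (filterS h); apply: nbhs_coordinates (fun=> [set r | 0 < r]) _ _.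
by move=> i; apply: open_nbhs_nbhs; split; [exact: open_gt|exact: z0].
Qed.

(** The domain is dense in the orthant, so it has a point near [z / 2] that lies below [z];
    monotonicity does the rest. *)
Lemma utility_dom_pos U z : utility_function U -> supported_on U orthant ->
  (forall i, 0 < z 0 i) -> dom U z.
Proof.
rewrite /supported_on => -[_ _ _ _ incU] suppU z0.
rewrite suppU in incU.
have : support_cone U (2^-1 *: z).
  by rewrite suppU => i; rewrite mxE mulr_ge0 ?invr_ge0// ltW.
have hz : nbhs (2^-1 *: z) [set x : 'rV[R]_n | forall i, x 0 i < z 0 i].
  apply: (@nbhs_coordinates (fun i => [set r | r < z 0 i])) => i.
  apply: open_nbhs_nbhs; split; first exact: open_lt.
  by rewrite /= mxE gtr_pMl// invf_lt1// ltr1n.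
move=> /(_ _ hz)[x [Ux xz]]; apply: (lt_le_trans Ux); apply: incU => i.
by rewrite !mxE subr_ge0 ltW.
Qed.

Lemma supergradient_ge0 f z q : cone_increasing orthant f ->
  f z \is a fin_num -> superdifferential f z q -> orthant q.
Proof.
move=> incf fz fq i.
have zi : z + basis_vector i - z = basis_vector i by rewrite addrAC subrr add0r.
have : (f z <= f (z + basis_vector i)%R)%E.
  by apply: incf; rewrite zi; exact: orthant_basis.
move=> /le_trans/(_ (fq _)); rewrite zi dotv_basis.
by rewrite -(fineK fz) -EFinD lee_fin lerDl.
Qed.

(* The growth condition on the dual function in primal terms. With q a
   supergradient of U at z = l eps x + 1, Fenchel's inequality at eps q gives
   U x <= U^*(eps q) + eps <x, q>, and U^*(q) = U z - <z, q>. *)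
Lemma primal_growth U eps : utility_function U -> supported_on U orthant ->
  dual_growth_condition U -> 0 < eps <= 1 ->
  exists (l k : R), 0 < l /\ forall x,
    (l%:E * U x + k%:E <= U ((l * eps) *: x + const_mx 1)%R)%E.
Proof.
move=> uU sU [zeta [zeta0 growth]] /[dup] e01 /andP[e0 e1].
have domU := utility_dom_pos uU sU.
have domS : dom U `<=` orthant.
  by rewrite -sU; exact: subset_closure.
case: uU => -[cU _ Uoo] _ _ _; rewrite sU => incU.
have Upos x : (forall i, 0 < x 0 i) -> U x \is a fin_num.
  by move=> /domU Ux; rewrite fin_real// Ux Uoo.
have one_pos i : 0 < (const_mx 1 : 'rV[R]_n) 0 i by rewrite mxE.
pose b1 := fine (U (const_mx 1)).
have U1 : U (const_mx 1) = b1%:E by rewrite fineK// Upos.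
(* The multiplier [l] will be [c^-1]; the maximum with 1 keeps it defined when [zeta eps]
   vanishes. *)
pose c := Num.max (zeta eps) 1.
have c1 : 1 <= c by rewrite le_max lexx orbT.
have c0 : 0 < c by lra.
have zc : zeta eps <= c by rewrite le_max lexx.
have zeta_ge0 := zeta0 _ e01.
(* The term [zeta eps / c] pays for the [+ 1] in the growth bound, and the norm of [b1 = U(1)] for
   the case of a negative dual value. *)
exists c^-1, (- (zeta eps / c + `|b1|)); split; first by rewrite invr_gt0.
move=> x; have [Ux|] := boolP (-oo < U x)%E; last first.
  rewrite -leNgt leeNy_eq => /eqP ->.
  by rewrite mulrNy gtr0_sg ?invr_gt0// mul1e addNye leNye.
have x0 : orthant x by exact: domS.
have [a Ua] : exists a, U x = a%:E.
  by exists (fine (U x)); rewrite fineK// fin_real// Ux Uoo.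
(* The shift by 1 moves [z] off the boundary of the orthant, so that [U] has a supergradient
   there. *)
set z := (_ *: x + _).
have z0 i : 0 < z 0 i.
  rewrite !mxE ltr_wpDl// mulr_ge0 ?x0// mulr_ge0 ?invr_ge0 ?ltW//.
have iz : interior (dom U) z by apply: interior_pos => // y; exact: domU.
have [q qz] := supergradient_exists cU iz (Uoo z).
have q0 : orthant q by apply: supergradient_ge0 qz => //; exact: Upos.
pose b := fine (U z); have Uz : U z = b%:E by rewrite fineK// Upos.
rewrite Ua Uz -EFinM -EFinD lee_fin.
pose B := b - dotv z q.
(* [B] is the dual value at [q]. The growth condition speaks of interior points only and [q] may lie
   on the boundary, so [q] is shifted by [eta], which does not raise the bound because [dom U] lies
   in the orthant. Below, [eta] tends to 0. *)
have dualB eta : 0 < eta -> (dual_function U (q + const_mx eta) <= B%:E)%E.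
  move=> eta0; apply: ge_ereal_sup => _ [y _ <-].
  have [Uy|] := boolP (-oo < U y)%E; last first.
    by rewrite -leNgt leeNy_eq => /eqP ->; rewrite addNye leNye.
  have y0 : 0 <= dotv y (const_mx eta).
    by apply: dotv_ge0; [exact: domS|move=> i; rewrite mxE ltW].
  have := qz y; rewrite Uz; move: Uy (Uoo y).
  case: (U y) => [r| |]//= _ _; rewrite -!EFinD !lee_fin dotvDr /B dotvBl; lra.
have main eta : 0 < eta -> a <= zeta eps * (Num.max B 0 + 1) + eps * dotv x q
    + eta * dotv x (const_mx 1).
  move=> eta0; pose p := q + const_mx eta.
  have p_int : interior orthant p.
    apply: interior_pos => [i|y y0 i]; first by rewrite !mxE ltr_wpDl.
    exact/ltW/y0.
  have := growth eps p e01 p_int (le_lt_trans (dualB _ eta0) (ltry _)).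
  have : (maxe (dual_function U p) 0 + 1 <= (Num.max B 0 + 1)%:E)%E.
    rewrite EFinD leeD2r// ge_max EFin_max !le_max dualB//=.
    by rewrite lexx orbT.
  move=> /(@lee_wpmul2l _ (zeta eps)%:E) le1 /le_trans/(_ (le1 _)).
  rewrite lee_fin => /(_ zeta_ge0).
  have : (U x - (dotv x (eps *: p))%:E <= dual_function U (eps *: p))%E.
    by apply: ereal_sup_ubound; exists x.
  move=> /le_trans h /h; rewrite Ua -EFinM -EFinD lee_fin dotvZr /p dotvDr.
  have -> : const_mx eta = eta *: const_mx 1 :> 'rV[R]_n.
    by apply/rowP => i; rewrite !mxE mulr1.
  rewrite dotvZr.
  have : eps * (eta * dotv x (const_mx 1)) <= eta * dotv x (const_mx 1).
    rewrite ler_piMl// mulr_ge0 ?(ltW eta0)// dotv_ge0// => i; exact/ltW/one_pos.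
  move: (zeta eps * _) => K; lra.
have {}main : a <= zeta eps * (Num.max B 0 + 1) + eps * dotv x q.
  have x10 : 0 <= dotv x (const_mx 1).
    by apply: dotv_ge0 => // i; exact/ltW/one_pos.
  apply/ler_addgt0Pr => e ee; pose eta := e / (1 + dotv x (const_mx 1)).
  have eta0 : 0 < eta by rewrite divr_gt0// ltr_wpDr.
  apply: (le_trans (main _ eta0)); rewrite lerD2l /eta mulrAC.
  by rewrite ler_pdivrMr ?ltr_wpDr// ler_pM2l// lerDr.
(* The choice [z - 1 = (eps / c) x] makes [c <z, q>] cancel against the same term in
   [c * B = c * (b - <z, q>)]. *)
have xz : eps * dotv x q = c * (dotv z q - dotv (const_mx 1) q).
  have zx : dotv (z - const_mx 1) q = c^-1 * eps * dotv x q.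
    by rewrite /z addrK; exact: dotvZl.
  by rewrite -dotvBl zx -mulrA mulVKf// gt_eqF.
have q1 : 0 <= dotv (const_mx 1) q by apply: dotv_ge0 => // i; exact/ltW/one_pos.
have b1z := qz (const_mx 1).
rewrite U1 Uz -EFinD lee_fin dotvBl in b1z.
rewrite xz in main.
have b1n := ler_norm (- b1); rewrite normrN in b1n.
have b1p := normr_ge0 b1.
rewrite -(ler_pM2l c0).
have -> : c * (c^-1 * a - (zeta eps / c + `|b1|)) = a - zeta eps - c * `|b1|.
  by field; rewrite gt_eqF.
have cb : 0 <= c * `|b1| by rewrite mulr_ge0// ltW.
have cq : 0 <= c * dotv (const_mx 1) q by rewrite mulr_ge0// ltW.
have [B0|B0] := leP 0 B.
  rewrite max_l// /B in main.
  have zB : zeta eps * B <= c * B by rewrite ler_wpM2r.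
  move: zB; rewrite /B; lra.
(* For [B < 0] nothing is left to cancel; the supergradient inequality at the vector 1 bounds
   [<z - 1, q>] by [b - b1] instead. *)
rewrite max_r ?(ltW B0)// in main.
have : c * (dotv z q - dotv (const_mx 1) q) <= c * (b + `|b1|).
  by rewrite ler_pM2l//; lra.
lra.
Qed.

(** The right-hand side of the growth inequality is at most affine with slope [l eps q]. Division by
    [l] removes [l] from the slope, so its size is controlled by [eps] alone, whatever [l], [k] and
    [y] belong to that [eps]. *)
Lemma growth_asymptotically_satiable f x0 :
  concave f -> cone_increasing orthant f ->
  interior (dom f) x0 -> (f x0 < +oo)%E ->
  (forall eps : R, 0 < eps <= 1 -> exists (l k : R) y, 0 < l /\
    forall x, (l%:E * f x + k%:E <= f ((l * eps) *: x + y)%R)%E) ->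
  asymptotically_satiable f.
Proof.
move=> cf incf ix0 fx0 growth.
have dx0 : dom f x0 by exact: interior_subset ix0.
apply: asymptotically_satiableP => //; first by exists x0.
have [q qx0] := supergradient_exists cf ix0 fx0.
have [a fa] : exists a, f x0 = a%:E.
  by exists (fine (f x0)); rewrite fineK// fin_real// fx0 dx0.
move=> e e0; pose s := \sum_(i < n) `|q 0 i|.
have s0 : 0 <= s by apply: sumr_ge0.
have es0 : 0 < e + s + 1 by lra.
(* With [s] the sum of the [|q_i|], this gives both [eps <= 1] and [eps * q_i < e]. *)
pose eps := e / (e + s + 1).
have eps0 : 0 < eps by rewrite divr_gt0.
have eps1 : eps <= 1 by rewrite ler_pdivrMr// mul1r; lra.
have [|l [k [y [l0 lk]]]] := growth eps; first by rewrite eps0.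
exists (eps *: q), (l^-1 * (a + dotv (y - x0) q - k)); split=> [i|x].
  rewrite mxE /eps mulrAC ltr_pdivrMr// ltr_pM2l//.
  have : `|q 0 i| <= s by rewrite /s (bigD1 i)//= lerDl sumr_ge0.
  have := ler_norm (q 0 i); lra.
have dE : dotv ((l * eps) *: x + y - x0) q = l * (eps * dotv x q) + dotv (y - x0) q.
  rewrite -addrA; apply: etrans (dotvDl _ _ _) _; congr (_ + _).
  by rewrite mulrA; exact: dotvZl.
have := le_trans (lk x) (qx0 _); rewrite fa dE -EFinD dotvZr.
case: (f x) => [r| |].
- rewrite -EFinM -EFinD !lee_fin -(ler_pM2l l0 r) mulrDr mulVKf ?gt_eqF//; lra.
- by rewrite mulry gtr0_sg// mul1e addye.
- by rewrite leNye.
Qed.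

Lemma bounded_asymptotically_satiable f : concave f ->
  cone_increasing orthant f -> dom f !=set0 -> bounded_above f ->
  asymptotically_satiable f.
Proof.
move=> cf incf f0 [M fM]; apply: asymptotically_satiableP => // eps eps0.
exists 0, M; split=> [i|x]; first by rewrite mxE.
by rewrite dotvC /dotv big1 ?addr0// => i _; rewrite mxE mul0r.
Qed.

End Growth.

(** * Expectations of functions with possibly nonintegrable parts *)

Section Expectation.
Context {R : realType} {disp : measure_display} {Omega : measurableType disp}.
Variable P : probability Omega R.
Implicit Types (f g h : Omega -> \bar R).
Local Open Scope ereal_scope.

(** [expected_utility] with utility and terminal value merged into one function, and convertible
    with it. In this form constants can take the place of utilities. *)
Definition lower_expectation f : \bar R :=
  if \int[P]_w f^\- w == +oo then -oo else \int[P]_w f w.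

Lemma integral_funeneg_fin f : \int[P]_w f^\- w != +oo ->
  \int[P]_w f^\- w \is a fin_num.
Proof. by move=> foo; rewrite ge0_fin_numE ?integral_ge0// lt_neqAle foo leey. Qed.

Lemma lower_expectation_gtNy f : -oo < lower_expectation f ->
  \int[P]_w f^\- w \is a fin_num /\
  lower_expectation f = \int[P]_w f^\+ w - \int[P]_w f^\- w.
Proof.
rewrite /lower_expectation; case: eqP => [|/eqP foo _]; first by rewrite ltxx.
by split; [exact: integral_funeneg_fin|rewrite integralE].
Qed.

Lemma ge0_integral_combination (l m : R) f g : (0 <= l)%R -> (0 <= m)%R ->
  measurable_fun setT f -> measurable_fun setT g ->
  (forall w, 0 <= f w) -> (forall w, 0 <= g w) ->
  \int[P]_w (l%:E * f w + m%:E * g w) =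
  l%:E * \int[P]_w f w + m%:E * \int[P]_w g w.
Proof.
move=> l0 m0 mf mg f0 g0.
rewrite ge0_integralD//; first by rewrite !ge0_integralZl_EFin.
- by move=> w _; rewrite mule_ge0.
- exact: measurable_funeM.
- by move=> w _; rewrite mule_ge0.
- exact: measurable_funeM.
Qed.

(* Both sides are nonnegative forms of l f + m g <= h, so that they can be
   integrated term by term without integrability of the positive parts. *)
Lemma posneg_combination (l m : R) (a b c : \bar R) : (0 < l)%R -> (0 < m)%R ->
  a < +oo -> b < +oo -> c < +oo -> l%:E * a + m%:E * b <= c ->
  maxe (- c) 0 + (l%:E * maxe a 0 + m%:E * maxe b 0) <=
    maxe c 0 + (l%:E * maxe (- a) 0 + m%:E * maxe (- b) 0) /\
  maxe (- c) 0 <= l%:E * maxe (- a) 0 + m%:E * maxe (- b) 0.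
Proof.
move=> l0 m0.
have pos (x : \bar R) : 0 <= maxe x 0 by rewrite le_max lexx orbT.
have ly : l%:E * +oo = +oo by rewrite mulry gtr0_sg// mul1e.
have my : m%:E * +oo = +oo by rewrite mulry gtr0_sg// mul1e.
have lpos x : 0 <= l%:E * maxe x 0 by rewrite mule_ge0// lee_fin ltW.
have mpos x : 0 <= m%:E * maxe x 0 by rewrite mule_ge0// lee_fin ltW.
have nNy (x : \bar R) : 0 <= x -> x != -oo by case: x.
case: a => [a| |]// _; last first.
  move=> _ _ _; have -> : maxe (- -oo) 0 = +oo :> \bar R by rewrite maxye.
  by rewrite ly addye ?nNy// addey ?nNy// !leey.
case: b => [b| |]// _; last first.
  move=> _ _; have -> : maxe (- -oo) 0 = +oo :> \bar R by rewrite maxye.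
  by rewrite my !addey ?nNy// !leey.
case: c => [c| |]// _.
rewrite -!EFinN -!EFin_max -!EFinM -!EFinD !lee_fin => le.
have E (x : R) : (Num.max x 0 = x + Num.max (- x) 0)%R.
  by have [x0|x0] := leP x 0%R;
    [rewrite max_l ?oppr_ge0// subrr|rewrite max_r ?addr0// oppr_le0 ltW].
have ha : (0 <= l * Num.max (- a) 0)%R by rewrite mulr_ge0 ?(ltW l0)// le_max lexx orbT.
have hb : (0 <= m * Num.max (- b) 0)%R by rewrite mulr_ge0 ?(ltW m0)// le_max lexx orbT.
have la : (l * Num.max a 0 = l * a + l * Num.max (- a) 0)%R by rewrite E mulrDr.
have mb : (m * Num.max b 0 = m * b + m * Num.max (- b) 0)%R by rewrite E mulrDr.
have la0 : (0 <= l * Num.max a 0)%R by rewrite mulr_ge0 ?(ltW l0)// le_max lexx orbT.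
have mb0 : (0 <= m * Num.max b 0)%R by rewrite mulr_ge0 ?(ltW m0)// le_max lexx orbT.
rewrite la mb in la0 mb0 *; split; first by rewrite (E c); lra.
by rewrite ge_max; apply/andP; split; lra.
Qed.

(** The single source of all properties of the value function: with suitable [g] it yields
    concavity, growth, monotonicity and upper bounds. *)
Lemma lower_expectation_combination (l m : R) f g h : (0 < l)%R -> (0 < m)%R ->
  measurable_fun setT f -> measurable_fun setT g -> measurable_fun setT h ->
  (forall w, f w < +oo) -> (forall w, g w < +oo) -> (forall w, h w < +oo) ->
  (forall w, l%:E * f w + m%:E * g w <= h w) ->
  -oo < lower_expectation f -> -oo < lower_expectation g ->
  l%:E * lower_expectation f + m%:E * lower_expectation g <= lower_expectation h.
Proof.
move=> l0 m0 mf mg mh foo goo hoo lmh /lower_expectation_gtNy[fn ->].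
move=> /lower_expectation_gtNy[gn ->].
have mfp := measurable_funepos mf; have mfn := measurable_funeneg mf.
have mgp := measurable_funepos mg; have mgn := measurable_funeneg mg.
have mhp := measurable_funepos mh; have mhn := measurable_funeneg mh.
have pw w := posneg_combination l0 m0 (foo w) (goo w) (hoo w) (lmh w).
have mcomb (p q : Omega -> \bar R) : measurable_fun setT p -> measurable_fun setT q ->
    measurable_fun setT (fun w => l%:E * p w + m%:E * q w).
  by move=> mp mq; apply: emeasurable_funD; exact: measurable_funeM.
have comb0 (p q : Omega -> \bar R) : (forall w, 0 <= p w) -> (forall w, 0 <= q w) ->
    forall w, 0 <= l%:E * p w + m%:E * q w.
  by move=> p0 q0 w; rewrite adde_ge0// mule_ge0// lee_fin ltW.
(* This excludes the conventional value [-oo] for [h]. *)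
have hle : \int[P]_w h^\- w <= l%:E * \int[P]_w f^\- w + m%:E * \int[P]_w g^\- w.
  rewrite -ge0_integral_combination ?(ltW l0) ?(ltW m0)//.
  apply: ge0_le_integral => //.
  - exact: mcomb.
  - by move=> w _; rewrite !funenegE; case: (pw w).
have hn : \int[P]_w h^\- w \is a fin_num.
  rewrite ge0_fin_numE ?integral_ge0//; apply: le_lt_trans hle _.
  by rewrite -(fineK fn) -(fineK gn) -!EFinM -EFinD ltry.
(* The integrals of the negative parts are finite and may change sides afterwards; those of the
   positive parts may be [+oo]. *)
have main : \int[P]_w h^\- w + (l%:E * \int[P]_w f^\+ w + m%:E * \int[P]_w g^\+ w)
    <= \int[P]_w h^\+ w + (l%:E * \int[P]_w f^\- w + m%:E * \int[P]_w g^\- w).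
  rewrite -!ge0_integral_combination ?(ltW l0) ?(ltW m0)//.
  rewrite -!ge0_integralD//; try exact: mcomb; last 2 first.
  - by move=> w _; exact: comb0.
  - by move=> w _; exact: comb0.
  apply: ge0_le_integral => //.
  - by move=> w _; rewrite adde_ge0//; exact: comb0.
  - by apply: emeasurable_funD => //; exact: mcomb.
  - by apply: emeasurable_funD => //; exact: mcomb.
  - by move=> w _; rewrite !funenegE !funeposE; case: (pw w).
have -> : lower_expectation h = \int[P]_w h^\+ w - \int[P]_w h^\- w.
  by rewrite /lower_expectation; case: eqP hn => [->|_ _]; [|exact: integralE].
have fp : 0 <= \int[P]_w f^\+ w by exact: integral_ge0.
have gp : 0 <= \int[P]_w g^\+ w by exact: integral_ge0.
have hp : 0 <= \int[P]_w h^\+ w by exact: integral_ge0.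
move: main fp gp hp.
rewrite -(fineK fn) -(fineK gn) -(fineK hn).
move: (fine _) (fine _) (fine _) => F G H.
have ly : l%:E * +oo = +oo by rewrite mulry gtr0_sg// mul1e.
have my : m%:E * +oo = +oo by rewrite mulry gtr0_sg// mul1e.
move: (\int[P]_w f^\+ w) (\int[P]_w g^\+ w) (\int[P]_w h^\+ w).
case=> [f1| |]//; case=> [g1| |]//; case=> [h1| |]//=;
  rewrite ?addye// ?ly ?my ?addye ?addey ?ly ?my ?addye ?addey ?leey//.
rewrite -!EFinB -!EFinM -!EFinD !lee_fin; lra.
Qed.

Lemma lower_expectation_cst (k : R) : lower_expectation (cst k%:E) = k%:E.
Proof.
rewrite /lower_expectation (eq_integral (cst (Num.max (- k) 0)%:E)).
  by rewrite !integral_cst//= probability_setT !mule1.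
by move=> w _; rewrite funenegE EFin_max.
Qed.

End Expectation.

(** * Borel measurability of vector-valued maps and of the extended utility *)

Section BorelMeasurability.
Context {R : realType}.

Lemma sigma_algebraI (S : Type) (G : set (set S)) A B :
  sigma_algebra setT G -> G A -> G B -> G (A `&` B).
Proof.
move=> [G0 GC GU] GA GB.
have -> : A `&` B = setT `\` \bigcup_k (if k == 0%N then setT `\` A else setT `\` B).
  apply/seteqP; split=> [s [As Bs]|s [_ h]].
    by split=> // -[k _]; case: ifP => _ [].
  split; apply: contrapT => h'; apply: h; first by exists 0%N.
  by exists 1%N.
by apply: (GC); apply: GU => k; case: ifP => _; exact: GC.
Qed.

Lemma sigma_algebra_bigcup (S : Type) (I : countType) (G : set (set S))
    (A : I -> set S) :
  sigma_algebra setT G -> (forall i, G (A i)) -> G (\bigcup_i A i).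
Proof.
move=> [G0 GC GU] GA.
have -> : \bigcup_i A i = \bigcup_k (if unpickle k is Some i then A i else set0).
  apply/seteqP; split=> [s [i _ Ais]|s [k _]].
    by exists (pickle i) => //; rewrite pickleK.
  by case: unpickle => // i Ais; exists i.
by apply: GU => k; case: unpickle.
Qed.

Lemma borel_measurable_wrt_open (S : Type) (E : topologicalType)
    (G : set (set S)) (X : S -> E) : sigma_algebra setT G ->
  (forall O, open O -> G (X @^-1` O)) -> borel_measurable_wrt G X.
Proof.
move=> [G0 GC GU] GO; apply: (smallest_sub (X := [set B | G (X @^-1` B)])) => //.
split=> /= [|A GA|A GA].
- by rewrite preimage_set0.
- by rewrite setTD preimage_setC -setTD; exact: GC.
- by rewrite preimage_bigcup; exact: GU.
Qed.

Lemma borel_open (E : topologicalType) (O : set E) : open O -> borel O.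
Proof. exact: sub_sigma_algebra. Qed.

Lemma borel_measurable_wrt_comp (S : Type) (E E' : topologicalType)
    (G : set (set S)) (X : S -> E) (f : E -> E') :
  borel_measurable_wrt G X -> borel_measurable_wrt (@borel E) f ->
  borel_measurable_wrt G (f \o X).
Proof. by move=> GX bf B /bf /GX. Qed.

Lemma borel_measurable_wrt_continuous (E E' : topologicalType) (f : E -> E') :
  continuous f -> borel_measurable_wrt (@borel E) f.
Proof.
move=> cf; apply: borel_measurable_wrt_open => [|O oO].
  exact: smallest_sigma_algebra.
by apply: borel_open; apply: open_comp => // x _; exact: cf.
Qed.

Lemma rational_approximation n (x : 'rV[R]_n) (e : R) : 0 < e ->
  exists a : 'rV[rat]_n, ball (map_mx ratr a : 'rV[R]_n) e x.
Proof.
move=> e0; have /choice[a aP] i : exists q : rat, `|ratr q - x 0 i| < e.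
  have /rat_in_itvoo[q] : x 0 i - e < x 0 i + e by lra.
  by rewrite in_itv/= => /andP[q1 q2]; exists q; rewrite ltr_distl q1 q2.
exists (\row_i a i); split=> // i j; rewrite !mxE ord1.
exact: aP.
Qed.

(* 'rV[R]_n is second countable: an open set of pairs is the union of the
   products of rational balls that it contains. *)
Lemma borel_measurable_wrt_pair (S : Type) n (G : set (set S))
    (X Y : S -> 'rV[R]_n) (W : set ('rV[R]_n * 'rV[R]_n)) :
  sigma_algebra setT G -> borel_measurable_wrt G X -> borel_measurable_wrt G Y ->
  open W -> G [set s | W (X s, Y s)].
Proof.
move=> sG GX GY oW.
pose Q := ('rV[rat]_n * 'rV[rat]_n * nat)%type.
pose A (i : Q) : set 'rV[R]_n := ball (map_mx ratr i.1.1 : 'rV[R]_n) (i.2.+1%:R^-1 : R).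
pose B (i : Q) : set 'rV[R]_n := ball (map_mx ratr i.1.2 : 'rV[R]_n) (i.2.+1%:R^-1 : R).
pose C (i : Q) : set S := if `[< A i `*` B i `<=` W >] then
  (X @^-1` A i) `&` (Y @^-1` B i) else set0.
have -> : [set s | W (X s, Y s)] = \bigcup_i C i.
  apply/seteqP; split=> [s Ws|s [i _]]; last first.
    rewrite /C; case: asboolP => // AB [As Bs]; exact: (AB (X s, Y s)).
  have /nbhs_ballP[e /= e0 eW] : nbhs (X s, Y s) W by apply: open_nbhs_nbhs.
  have [k] := @ltr_add_invr R 0 (e / 2) (divr_gt0 e0 (ltr0Sn _ 1)).
  rewrite add0r => ke.
  have ke2 : k.+1%:R^-1 + k.+1%:R^-1 <= e by rewrite (splitr e) lerD ?ltW.
  have k0 : 0 < k.+1%:R^-1 :> R by rewrite invr_gt0.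
  have [a Xa] := rational_approximation (X s) k0.
  have [b Yb] := rational_approximation (Y s) k0.
  exists (a, b, k) => //; rewrite /C; case: asboolP => [_|[]]; first by split.
  move=> [x y] [/= ax bY]; apply: eW; split.
    apply: (le_ball ke2).
    by apply: (ball_triangle (ball_sym Xa)).
  apply: (le_ball ke2).
  by apply: (ball_triangle (ball_sym Yb)).
apply: sigma_algebra_bigcup => // i; rewrite /C; case: ifP => _; last by case: sG.
by apply: sigma_algebraI => //; [apply: GX|apply: GY];
  apply: borel_open; exact: ball_open.
Qed.

Lemma borel_measurable_wrt_combination (S : Type) n (G : set (set S)) (l m : R)
    (X Y : S -> 'rV[R]_n) : sigma_algebra setT G ->
  borel_measurable_wrt G X -> borel_measurable_wrt G Y ->
  borel_measurable_wrt G (fun s => l *: X s + m *: Y s).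
Proof.
move=> sG GX GY; apply: borel_measurable_wrt_open => // O oO.
apply: (borel_measurable_wrt_pair (W := (fun p => l *: p.1 + m *: p.2) @^-1` O)) => //.
apply: open_comp => // p _; apply: cvgD; first by apply: cvgZr; exact: cvg_fst.
by apply: cvgZr; exact: cvg_snd.
Qed.

Lemma borel_measurable_wrt_measurable_fun disp (Omega : measurableType disp)
    (f : Omega -> \bar R) : borel_measurable_wrt measurable f ->
  measurable_fun setT f.
Proof.
move=> bf; apply: (measurability _ (ErealGenOInfty.measurableE R)) => //.
move=> _ [_ [r ->] <-]; rewrite setTI; apply: bf; apply: borel_open.
exact: rray_open.
Qed.

Lemma borel_measurable_utility_extension d D (hdD : (d <= D)%N)
    (U : 'rV[R]_d -> \bar R) : borel_measurable_wrt (@borel 'rV[R]_d) U ->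
  borel_measurable_wrt (@borel 'rV[R]_D) (utility_extension hdD U).
Proof.
move=> bU; have sB : sigma_algebra setT (@borel 'rV[R]_D).
  exact: smallest_sigma_algebra.
have sBC (A : set 'rV[R]_D) : borel A -> borel (~` A).
  by case: sB => _ sBD _ bA; have := sBD _ bA; rewrite setTD.
have sBI (A B : set 'rV[R]_D) : borel A -> borel B -> borel (A `&` B).
  exact: sigma_algebraI.
have orthB : borel (@orthant R D).
  rewrite -[orthant]setCK; apply: (sBC); apply: borel_open; apply: closed_openC.
  have -> : @orthant R D = \bigcap_i [set x | 0 <= x 0 i].
    by apply/seteqP; split=> [x x0 i _|x x0 i]; [exact: x0|exact: x0].
  apply: closed_bigI => i _.
  apply: (preimage_closed (f := fun x : 'rV[R]_D => x 0 i) (D := [set r : R | 0 <= r])).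
    by move=> x _; exact: coord_continuous.
  exact: closed_ge.
pose proj (x : 'rV[R]_D) : 'rV[R]_d := \row_(i < d) x 0 (widen_ord hdD i).
have bproj : borel_measurable_wrt (@borel 'rV[R]_D) proj.
  apply: borel_measurable_wrt_continuous => x A [P xP PA].
  have : \forall y \near x, forall i : 'I_d, P 0 i ((y : 'rV[R]_D) 0 (widen_ord hdD i)).
    apply: (@filter_forall _ _ (fun i (y : 'rV[R]_D) => P 0 i (y 0 (widen_ord hdD i)))
      (nbhs x) (nbhs_filter x)) => i.
    apply: (@coord_continuous R 1 D 0 (widen_ord hdD i) x).
    by have := xP 0 i; rewrite mxE.
  by apply: filterS => y yP; apply: PA => j i; rewrite mxE ord1.
move=> B bB.
have -> : utility_extension hdD U @^-1` B =
    (orthant `&` (U \o proj) @^-1` B) `|`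
    (~` orthant `&` (if `[< B -oo%E >] then setT else set0)).
  apply/seteqP; split=> x; rewrite /utility_extension /=;
    have [x0|x0] := pselect (orthant x); rewrite ?(asboolT x0) ?(asboolF x0).
  - by left.
  - by move=> Bx; right; split=> //; rewrite asboolT.
  - by case=> [[]//|[]//].
  - by case=> [[]//|[_]]; case: asboolP.
rewrite -[X in borel X]setCK setCU; apply: (sBC); apply: (sBI); apply: (sBC).
  by apply: (sBI) => //; exact: (borel_measurable_wrt_comp bproj bU).
apply: (sBI); first exact: sBC.
case: ifP => _; last by case: sB.
by rewrite -setC0; apply: (sBC); case: sB.
Qed.

End BorelMeasurability.

(** * Predictable processes: linear combinations and terminal values *)

Section Predictable.
Context {R : realType} {disp : measure_display} {Omega : measurableType disp}.
Variables (T : R) (F : R -> set (set Omega)).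
Hypotheses (hT : 0 < T) (hF : filtration T F).

(** Predictable sets form a sigma-algebra on [[0, T]] times [Omega] only. Taking the sets with
    predictable trace gives one on the whole product, to which the general measurability lemmas
    apply. *)
Let G : set (set (R * Omega)) :=
  [set A | predictable_sets T F ((`[0, T] `*` setT) `&` A)].

Let sigma_algebra_G : sigma_algebra setT G.
Proof.
have [P0 PC PU] : sigma_algebra (`[0, T] `*` setT) (predictable_sets T F).
  exact: smallest_sigma_algebra.
split=> [|A GA|A GA]; rewrite /G/=.
- by rewrite setI0.
- rewrite setTD; have := PC _ GA; rewrite setDE setCI setIUr setICr set0U.
  exact.
- by rewrite setI_bigcupr; exact: PU.
Qed.

Lemma predictable_process_wrt n (V : R -> Omega -> 'rV[R]_n) :
  predictable_process T F V <-> borel_measurable_wrt G (fun p => V p.1 p.2).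
Proof.
have E B : [set p : R * Omega | 0 <= p.1 <= T /\ B (V p.1 p.2)] =
    (`[0, T] `*` setT) `&` (fun p => V p.1 p.2) @^-1` B.
  apply/seteqP; split=> -[t w]/=; first by rewrite in_itv/= => -[].
  by rewrite in_itv/= => -[[]].
by split=> h B bB; have := h B bB; rewrite /G/= E.
Qed.

Lemma predictable_process_combination n (l m : R) (V V' : R -> Omega -> 'rV[R]_n) :
  predictable_process T F V -> predictable_process T F V' ->
  predictable_process T F (fun t w => l *: V t w + m *: V' t w).
Proof.
move=> /predictable_process_wrt pV /predictable_process_wrt pV'.
apply/predictable_process_wrt; exact: borel_measurable_wrt_combination.
Qed.

Lemma predictable_process_cst n (x : 'rV[R]_n) :
  predictable_process T F (fun _ _ => x).
Proof.
apply/predictable_process_wrt; apply: borel_measurable_wrt_open => // O _.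
case: sigma_algebra_G => G0 GC _.
have [xO|xO] := pselect (O x).
  rewrite (_ : _ @^-1` O = setT `\` set0); first exact: GC.
  by apply/seteqP; split=> // p _; split.
by rewrite (_ : _ @^-1` O = set0)//; apply/seteqP; split.
Qed.

(** Makes terminal values random variables. The section at [T] of a generator is empty or a set of
    some [F s]; for generators over time 0 this uses [0 < T]. *)
Lemma predictable_section A : predictable_sets T F A ->
  measurable [set w | A (T, w)].
Proof.
have [F1 F2 F3] := hF; have T0 := ltW hT.
apply: (smallest_sub (X := [set A : set (R * Omega) | measurable [set w | A (T, w)]])).
  split=> /= [|B mB|B mB].
  - by rewrite (_ : [set w | _] = set0)//; apply/seteqP; split.
  - rewrite (_ : [set w | _] = ~` [set w | B (T, w)]); first exact: measurableC.
    apply/seteqP; split=> w /=; first by case.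
    by move=> nB; split=> //; split=> //=; rewrite in_itv/= T0 lexx.
  - rewrite (_ : [set w | _] = \bigcup_k [set w | B k (T, w)]).
      exact: bigcupT_measurable.
    by apply/seteqP; split.
move=> _ [[B FB ->]|[s [t [B [s0 st tT FB ->]]]]] /=.
  rewrite (_ : [set w | _] = set0)//; apply/seteqP; split=> // w [/= T00].
  by have := hT; rewrite T00 ltxx.
have mB : measurable B by apply: (F2 s) FB; rewrite s0 (le_trans (ltW st)).
have [tE|tE] := pselect (s < T <= t).
  rewrite (_ : [set w | _] = B)//; apply/seteqP; split=> w /=; first by case.
  by split=> //=; rewrite in_itv.
by rewrite (_ : [set w | _] = set0)//; apply/seteqP; split=> // w [/=]; rewrite in_itv.
Qed.

Lemma predictable_process_terminal n (V : R -> Omega -> 'rV[R]_n) :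
  predictable_process T F V -> borel_measurable_wrt measurable (V T).
Proof.
move=> pV B bB; have := predictable_section (pV B bB).
rewrite (_ : [set w | _] = V T @^-1` B)//; apply/seteqP; split=> w /=.
  by case.
by split=> //; rewrite lexx ltW.
Qed.

End Predictable.

(** * Solvency cones and closed conical hulls *)

Section Cones.
Context {R : realType} {n : nat}.
Implicit Types (x y v : 'rV[R]_n) (C : set 'rV[R]_n).

Lemma solvency_cone_convex_cone (Pi : 'M[R]_n) : convex_cone (solvency_cone Pi).
Proof.
move=> l m x y l0 m0 Kx Ky A [cA GA].
by apply: (cA) => //; [apply: Kx|apply: Ky]; split.
Qed.

Lemma orthant_solvency_cone (Pi : 'M[R]_n) : (0 < n)%N ->
  orthant `<=` solvency_cone Pi.
Proof.
move=> n0 x x0; have cK := @solvency_cone_convex_cone Pi.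
have Ke i : solvency_cone Pi (basis_vector i).
  by move=> A [_ GA]; apply: GA; left; exists i.
(* [convex_cone] admits the empty set, so the zero vector has to come from a generator, and the
   dimension must be positive. *)
have K0 : solvency_cone Pi 0.
  have := cK 0 0 _ _ (lexx 0) (lexx 0) (Ke (Ordinal n0)) (Ke (Ordinal n0)).
  by rewrite !scale0r addr0.
rewrite [x]row_basis_sum; apply: (big_ind (solvency_cone Pi)) => // [u v Ku Kv|i _].
  by have := cK 1 1 _ _ ler01 ler01 Ku Kv; rewrite !scale1r.
have := cK (x 0 i) 0 _ _ (x0 i) (lexx 0) (Ke i) (Ke i).
by rewrite scale0r addr0.
Qed.

(** Lets the trading constraints of two portfolios be added and scaled. The hull inherits stability
    under scaling from [C], and [l x + m y] is a convex combination scaled by [l + m], unless both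
    weights vanish. *)
Lemma closed_convex_hull_convex_cone C :
  (forall (l : R) v, 0 <= l -> C v -> C (l *: v)) ->
  convex_cone (closed_convex_hull C).
Proof.
move=> Cl; pose cvx A := convex_set (A : set (convex_lmodType 'rV[R]_n)).
pose A := smallest cvx C.
have cA (t : R) x y : 0 <= t <= 1 -> A x -> A y -> A (t *: x + (1 - t) *: y).
  move=> /andP[t0 t1] Ax Ay B [cB CB].
  have := cB x y (Itv01 t0 t1); rewrite !inE; apply.
    by apply: Ax; split.
  by apply: Ay; split.
have lA (l : R) x : 0 <= l -> A x -> A (l *: x).
  move=> l0; apply: (smallest_sub (X := [set x | A (l *: x)])) => [|v Cv].
    apply: convex_setP => t u v t01 Au Av /=.
    by rewrite scalerDr !scalerA !(mulrC l) -!scalerA; exact: cA.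
  by rewrite /= => B [_ CB]; apply: CB; exact: Cl.
move=> l m x y l0 m0; apply: closure_combination => {}x {}y Ax Ay.
have [lm0|lm0] := eqVneq (l + m) 0.
  have [-> ->] : l = 0 /\ m = 0.
    by move/eqP: lm0; rewrite paddr_eq0// => /andP[/eqP ? /eqP ?].
  by rewrite (scale0r y) addr0; exact: lA.
have lm : 0 < l + m by rewrite lt_neqAle eq_sym lm0 addr_ge0.
have -> : l *: x + m *: y =
    (l + m) *: ((l / (l + m)) *: x + (1 - l / (l + m)) *: y).
  rewrite scalerDr !scalerA mulrBr mulr1 mulrCA mulfV// mulr1.
  by rewrite addrAC subrr add0r.
apply: lA; first exact: ltW.
apply: cA => //; rewrite divr_ge0//= ?addr_ge0// ler_pdivrMr// mul1r lerDl//.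
Qed.

End Cones.

(** * Scaling of paths of bounded variation *)

Section BoundedVariation.
Context {R : realType}.

Lemma bounded_variationZ (a b l : R) (f : R -> R) :
  bounded_variation a b f -> bounded_variation a b (fun t => l * f t).
Proof.
move=> [M fM]; exists (`|l| * M) => _ [s abs <-].
have -> : variation a b (fun t => l * f t) s = `|l| * variation a b f s.
  rewrite /variation mulr_sumr; apply: eq_bigr => i _.
  by rewrite -mulrBr normrM.
by rewrite ler_wpM2l//; apply: fM; exact: variations_variation.
Qed.

End BoundedVariation.

(** * Positive combinations of admissible portfolios *)

Section Portfolios.
Context {R : realType} {disp : measure_display} {Omega : measurableType disp}.
Context {D : nat}.
Variables (P : probability Omega R) (T : R) (F : R -> set (set Omega)).
Variable Pi : R -> Omega -> 'M[R]_D.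
Hypotheses (hT : 0 < T) (hD : (0 < D)%N).
Implicit Types (V Z : R -> Omega -> 'rV[R]_D) (x : 'rV[R]_D).

Lemma stopping_time_range tau w : bounded_stopping_time T F tau ->
  0 <= tau w <= T.
Proof. by case=> /(_ w)[//|[t t0T [->]]]. Qed.

Let trading_cone (s t : R) w :=
  closed_convex_hull ((\bigcup_(r in `[s, t[) solvency_cone (Pi r w)) `|` [set 0]).

Let trading_cone_convex_cone s t w : convex_cone (trading_cone s t w).
Proof.
apply: closed_convex_hull_convex_cone => l v l0 [[r rst Kv]|->]; last first.
  by right; rewrite scaler0.
left; exists r => //.
have := solvency_cone_convex_cone l0 (lexx 0) Kv Kv.
by rewrite scale0r addr0.
Qed.

Lemma self_financing_combination (l m : R) V V' : 0 <= l -> 0 <= m ->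
  self_financing P T F Pi V -> self_financing P T F Pi V' ->
  self_financing P T F Pi (fun t w => l *: V t w + m *: V' t w).
Proof.
move=> l0 m0 [pV bV sV] [pV' bV' sV']; split.
- exact: predictable_process_combination.
- apply: filterS2 bV bV' => w bV bV' i.
  under eq_fun do rewrite !mxE.
  by apply: bounded_variationD => //; exact: bounded_variationZ.
- move=> s t Ts Tt st; apply: filterS2 (sV _ _ Ts Tt st) (sV' _ _ Ts Tt st).
  move=> w [v vK vE] [v' vK' vE']; exists (l *: v + m *: v').
    exact: trading_cone_convex_cone.
  by rewrite opprD -!scalerN vE vE' !scalerBr opprD addrACA.
Qed.

Lemma self_financing_cst x : self_financing P T F Pi (fun _ _ => x).
Proof.
split; first exact: predictable_process_cst.
- by apply: aeW => w i; apply: nondecreasing_bounded_variation.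
- move=> s t _ _ _; apply: aeW => w; exists 0; last by rewrite oppr0 subrr.
  by apply: subset_closure; apply: sub_gen_smallest; right.
Qed.

Lemma admissible_combination (l m : R) V V' : 0 < l -> 0 < m ->
  admissible P T F Pi V -> admissible P T F Pi V' ->
  admissible P T F Pi (fun t w => l *: V t w + m *: V' t w).
Proof.
move=> l0 m0 [a a0 [aK aZ]] [a' a'0 [aK' aZ']].
have E (v v' : 'rV[R]_D) : l *: v + m *: v' + const_mx (l * a + m * a') =
    l *: (v + const_mx a) + m *: (v' + const_mx a').
  by apply/rowP => i; rewrite !mxE; ring.
exists (l * a + m * a'); first by rewrite addr_gt0// mulr_gt0.
split.
  apply: filterS2 aK aK' => w K1 K2; rewrite E.
  by apply: solvency_cone_convex_cone => //; exact: ltW.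
move=> tau Z ttau sZ; apply: filterS2 (aZ _ _ ttau sZ) (aZ' _ _ ttau sZ) => w h h'.
by rewrite E dotvDl !dotvZl addr_ge0// mulr_ge0// ltW.
Qed.

(** A large enough [a] brings [x + a 1] into the orthant, which lies in every solvency cone and
    pairs nonnegatively with price processes. *)
Lemma admissible_cst x : admissible P T F Pi (fun _ _ => x).
Proof.
pose a := 1 + \sum_i `|x 0 i|.
have xa : orthant (x + const_mx a).
  move=> i; rewrite !mxE /a (bigD1 i)//=.
  have : 0 <= \sum_(j < D | j != i) `|x 0 j| by apply: sumr_ge0.
  have := ler_norm (- x 0 i); rewrite normrN; lra.
exists a; first by rewrite ltr_pwDl// sumr_ge0.
split; first by apply: aeW => w; exact: orthant_solvency_cone.
move=> tau Z ttau [[+ _ _ _] _ _] => Z0; apply: aeW => w.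
apply: dotv_ge0 => //.
by have [] := Z0 (tau w) w (stopping_time_range w ttau).
Qed.

Lemma admissible_portfolios_combination (l m : R) V V' x x' : 0 < l -> 0 < m ->
  admissible_portfolios P T F Pi x V -> admissible_portfolios P T F Pi x' V' ->
  admissible_portfolios P T F Pi (l *: x + m *: x')
    (fun t w => l *: V t w + m *: V' t w).
Proof.
move=> l0 m0 [sV aV V0] [sV' aV' V0']; split.
- by apply: self_financing_combination => //; exact: ltW.
- exact: admissible_combination.
- by apply: filterS2 V0 V0' => w -> ->.
Qed.

Lemma admissible_portfolios_cst x :
  admissible_portfolios P T F Pi x (fun _ _ => x).
Proof.
by split; [exact: self_financing_cst|exact: admissible_cst|exact: aeW].
Qed.

End Portfolios.

(** * Properties of [U] inherited by its extension *)

Section Extension.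
Context {R : realType}.
Variables (d D : nat) (hdD : (d <= D)%N) (U : 'rV[R]_d -> \bar R).
Hypotheses (uU : utility_function U) (sU : supported_on U orthant).
Let Ut := utility_extension hdD U.
Let proj (x : 'rV[R]_D) : 'rV[R]_d := \row_(i < d) x 0 (widen_ord hdD i).

Lemma orthant_combination n (l m : R) (x y : 'rV[R]_n) : 0 <= l -> 0 <= m ->
  orthant x -> orthant y -> orthant (l *: x + m *: y).
Proof. by move=> l0 m0 x0 y0 i; rewrite !mxE addr_ge0// mulr_ge0. Qed.

Lemma utility_extensionT x : orthant x -> Ut x = U (proj x).
Proof. by move=> x0; rewrite /Ut /utility_extension asboolT. Qed.

Lemma utility_extensionF x : ~ orthant x -> Ut x = -oo%E.
Proof. by move=> x0; rewrite /Ut /utility_extension asboolF. Qed.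

Lemma utility_extension_lty x : (Ut x < +oo)%E.
Proof.
have [x0|x0] := pselect (orthant x); last by rewrite utility_extensionF.
by rewrite utility_extensionT//; case: uU => -[].
Qed.

Lemma utility_extension_increasing : cone_increasing orthant Ut.
Proof.
move=> x x' xx'; have [x0|x0] := pselect (orthant x); last first.
  by rewrite utility_extensionF// leNye.
have x'0 : orthant x'.
  move=> i; have := xx' i; rewrite !mxE subr_ge0; exact: le_trans.
rewrite !utility_extensionT//; case: uU => _ _ _ _; rewrite sU; apply=> i.
by have := xx' (widen_ord hdD i); rewrite !mxE.
Qed.

(** Stated on values instead of hypographs, with both weights positive: this is the pointwise
    premise that [lower_expectation_combination] integrates. *)
Lemma utility_extension_concave (l : R) x y : 0 < l < 1 ->
  (l%:E * Ut x + (1 - l)%:E * Ut y <= Ut (l *: x + (1 - l) *: y)%R)%E.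
Proof.
move=> /andP[l0 l1]; have l10 : 0 < 1 - l by rewrite subr_gt0.
have mNy (c : R) : 0 < c -> (c%:E * -oo = -oo)%E.
  by move=> c0; rewrite mulrNy gtr0_sg// mul1e.
have [x0|x0] := pselect (orthant x); last first.
  by rewrite (utility_extensionF x0) mNy// addNye leNye.
have [y0|y0] := pselect (orthant y); last first.
  by rewrite (utility_extensionF y0) mNy// addeNy leNye.
rewrite !utility_extensionT//; last by apply: orthant_combination => //; exact: ltW.
have -> : proj (l *: x + (1 - l) *: y) = l *: proj x + (1 - l) *: proj y.
  by apply/rowP => i; rewrite !mxE.
case: uU => -[cU _ Uoo] _ _ _ _.
move: (Uoo (proj x)) (Uoo (proj y)).
case Ux: (U (proj x)) => [a| |]// _; last by rewrite mNy// addNye leNye.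
case Uy: (U (proj y)) => [b| |]// _; last by rewrite mNy// addeNy leNye.
by rewrite -!EFinM -EFinD; apply: concaveP => //; rewrite ?Ux ?Uy// !ltW.
Qed.

Lemma utility_extension_growth (c l k : R) : 0 < c -> 0 < l ->
  (forall x, (l%:E * U x + k%:E <= U (c *: x + const_mx 1)%R)%E) ->
  forall x, (l%:E * Ut x + k%:E <= Ut (c *: x + const_mx 1)%R)%E.
Proof.
move=> c0 l0 growth x; have [x0|x0] := pselect (orthant x); last first.
  by rewrite utility_extensionF// mulrNy gtr0_sg// mul1e addNye leNye.
rewrite !utility_extensionT//; last first.
  by move=> i; rewrite !mxE addr_ge0// mulr_ge0// ltW.
have -> : proj (c *: x + const_mx 1) = c *: proj x + const_mx 1.
  by apply/rowP => i; rewrite !mxE.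
exact: growth.
Qed.

End Extension.

(** * The value function *)

Lemma affine_ereal_sup_le (R : realType) (S : set \bar R) (l k : R) (B : \bar R) :
  0 < l -> (forall s, S s -> (l%:E * s + k%:E <= B)%E) ->
  (l%:E * ereal_sup S + k%:E <= B)%E.
Proof.
move=> l0; case: B => [b| |] h; last 2 first.
- by rewrite leey.
- suff -> : ereal_sup S = -oo%E by rewrite mulrNy gtr0_sg// mul1e.
  apply/eqP; rewrite -leeNy_eq; apply: ge_ereal_sup => s /h; case: s => [r| |].
  + by rewrite -EFinM -EFinD leeNy_eq.
  + by rewrite mulry gtr0_sg// mul1e addye.
  + by rewrite leNye.
have : (ereal_sup S <= ((b - k) / l)%:E)%E.
  apply: ge_ereal_sup => s /h; case: s => [r| |].
  - by rewrite -EFinM -EFinD !lee_fin ler_pdivlMr// mulrC lerBrDr.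
  - by rewrite mulry gtr0_sg// mul1e.
  - by rewrite leNye.
have l0' : (0 <= l%:E)%E by rewrite lee_fin ltW.
move=> /(lee_wpmul2l l0') /(leeD2r k%:E) /le_trans; apply.
by rewrite -EFinM -EFinD lee_fin mulrC divfK ?gt_eqF// subrK.
Qed.

Section ValueFunction.
Context {R : realType} {disp : measure_display} {Omega : measurableType disp}.
Context {D : nat}.
Variables (P : probability Omega R) (T : R) (F : R -> set (set Omega)).
Variables (Pi : R -> Omega -> 'M[R]_D) (f : 'rV[R]_D -> \bar R).
Hypotheses (hT : 0 < T) (hF : filtration T F) (hD : (0 < D)%N).
Hypotheses (bf : borel_measurable_wrt (@borel 'rV[R]_D) f).
Hypothesis foo : forall x, (f x < +oo)%E.
Let u := value_function P T F Pi f.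

Let measurable_terminal V x : admissible_portfolios P T F Pi x V ->
  measurable_fun setT (f \o V T).
Proof.
move=> [[pV _ _] _ _]; apply: borel_measurable_wrt_measurable_fun.
apply: borel_measurable_wrt_comp bf.
exact: (predictable_process_terminal hT hF).
Qed.

Let value_function_ge x V : admissible_portfolios P T F Pi x V ->
  (lower_expectation P (f \o V T) <= u x)%E.
Proof. by move=> aV; apply: ereal_sup_ubound; exists (V T) => //; exists V. Qed.

(** Each portfolio [V] from [x] competes at [c x + y] through [c V + y], with [y] held without
    trading. For [l = c = 1], [k = 0] this is monotonicity; for [c = l eps], [y = 1] it transfers
    the growth inequality. *)
Lemma value_function_affine (l k c : R) y : 0 < l -> 0 < c ->
  (forall x, (l%:E * f x + k%:E <= f (c *: x + y)%R)%E) ->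
  forall x, (l%:E * u x + k%:E <= u (c *: x + y)%R)%E.
Proof.
move=> l0 c0 h x; apply: affine_ereal_sup_le => // _ [_ [V aV <-] <-].
have aV' : admissible_portfolios P T F Pi (c *: x + y)
    (fun t w => c *: V t w + 1 *: y).
  have := admissible_portfolios_combination hT c0 ltr01 aV
    (admissible_portfolios_cst P T F Pi hD y).
  by rewrite scale1r.
apply: le_trans (value_function_ge aV').
rewrite -[expected_utility _ _ _]/(lower_expectation P (f \o V T)).
have [EV|] := boolP (-oo < lower_expectation P (f \o V T))%E; last first.
  by rewrite -leNgt leeNy_eq => /eqP ->; rewrite mulrNy gtr0_sg// mul1e leNye.
(* The constant [k] enters the combination as the expectation of a constant function with weight
   1. *)
rewrite -{1}(lower_expectation_cst P k) -[lower_expectation P (cst _)]mul1e.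
apply: lower_expectation_combination => //.
- exact: measurable_terminal aV.
- exact: measurable_terminal aV'.
- by move=> w; exact: foo.
- by move=> w; exact: ltry.
- by move=> w; exact: foo.
- by move=> w; rewrite mul1e /= scale1r; exact: h.
- by rewrite lower_expectation_cst ltNyr.
Qed.

Lemma value_function_increasing :
  cone_increasing orthant f -> cone_increasing orthant u.
Proof.
move=> incf x x' xx'.
have := @value_function_affine 1 0 1 (x' - x) ltr01 ltr01.
move=> /(_ _ x); rewrite mul1e adde0 scale1r [x + _]addrC subrK; apply=> z.
by rewrite mul1e adde0 scale1r; apply: incf; rewrite addrAC subrr add0r.
Qed.

Lemma value_function_concave :
  (forall (l : R) x y, 0 < l < 1 ->
    (l%:E * f x + (1 - l)%:E * f y <= f (l *: x + (1 - l) *: y)%R)%E) ->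
  concave u.
Proof.
move=> cf; apply/convex_setW => -[x r] [y s]; rewrite !inE /hypograph/=.
move=> rx sy t t0 t1; rewrite inE/=.
set l := t%:num in t0 t1 *; have l10 : 0 < 1 - l by rewrite subr_gt0.
(* Optimal portfolios need not exist; a loss of [e] provides portfolios whose expected utilities
   exceed [r - e] and [s - e]. *)
apply/lee_subgt0Pr => e e0; rewrite -EFinB.
have near_sup z q : (q%:E <= u z)%E -> exists V,
    admissible_portfolios P T F Pi z V /\
    ((q - e)%:E < lower_expectation P (f \o V T))%E.
  move=> qz; have : ((q - e)%:E < u z)%E.
    by apply: lt_le_trans qz; rewrite lte_fin ltrBlDr ltrDl.
  by move=> /ereal_sup_gt[_ [_ [V aV <-] <-] h]; exists V.
have [V [aV EV]] := near_sup _ _ rx.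
have [V' [aV' EV']] := near_sup _ _ sy.
have aW := admissible_portfolios_combination hT t0 l10 aV aV'.
apply: le_trans (value_function_ge aW).
apply: (@le_trans _ _ (l%:E * lower_expectation P (f \o V T)
    + (1 - l)%:E * lower_expectation P (f \o V' T))%E); last first.
  apply: lower_expectation_combination => //.
  - exact: measurable_terminal aV.
  - exact: measurable_terminal aV'.
  - exact: measurable_terminal aW.
  - by move=> w; exact: foo.
  - by move=> w; exact: foo.
  - by move=> w; exact: foo.
  - by move=> w; apply: cf; rewrite t0.
  - exact: lt_trans (ltNyr _) EV.
  - exact: lt_trans (ltNyr _) EV'.
apply: (@le_trans _ _ (l%:E * (r - e)%:E + (1 - l)%:E * (s - e)%:E)%E).
  rewrite -!EFinM -EFinD lee_fin.
  have -> : l * (r - e) + (1 - l) * (s - e) = l * r + (1 - l) * s - e by ring.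
  exact: lexx.
by apply: leeD; apply: lee_wpmul2l; rewrite ?lee_fin ?ltW.
Qed.

Lemma value_function_bounded : bounded_above f -> bounded_above u.
Proof.
move=> [M fM]; exists M => x; apply: ge_ereal_sup => _ [_ [V aV <-] <-].
rewrite -[expected_utility _ _ _]/(lower_expectation P (f \o V T)).
have [EV|] := boolP (-oo < lower_expectation P (f \o V T))%E; last first.
  by rewrite -leNgt leeNy_eq => /eqP ->; rewrite leNye.
(* Adding the zero function turns the combination lemma into monotonicity of the expectation. *)
suff : (1%:E * lower_expectation P (f \o V T) + 1%:E * lower_expectation P (cst 0%:E)
    <= lower_expectation P (cst M%:E))%E by rewrite !lower_expectation_cst !mul1e adde0.
apply: lower_expectation_combination => //.
- exact: measurable_terminal aV.
- by move=> w; exact: foo.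
- by move=> w; exact: ltry.
- by move=> w; exact: ltry.
- by move=> w; rewrite !mul1e adde0; exact: fM.
- by rewrite lower_expectation_cst ltNyr.
Qed.

End ValueFunction.

Theorem corollary3p7 (R : realType)
    (disp : measure_display) (Omega : measurableType disp)
    (P : probability Omega R) (T : R) (hT : 0 < T)
    (F : R -> set (set Omega))
    (hF : filtration T F) (hFusual : usual_conditions P T F)
    (d D : nat) (hd : (1 <= d)%N) (hdD : (d <= D)%N)
    (Pi : R -> Omega -> 'M[R]_D)
    (hPi : forall t w, 0 <= t <= T -> bid_ask_matrix (Pi t w))
    (hPi_adapted : adapted T F Pi) (hPi_cadlag : cadlag T Pi)
    (hF_left : left_sigma_algebra F T = F T)
    (hPi_left : {ae P, forall w, left_limit Pi T w = Pi T w})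
    (hZs : exists Z, strictly_consistent_price_process P T F Pi Z)
    (U : 'rV[R]_d -> \bar R)
    (hU_borel : borel_measurable_wrt (@borel 'rV[R]_d) U)
    (hU : utility_function U) (hU_supp : supported_on U orthant)
    (hfin : let u := value_function P T F Pi (utility_extension hdD U) in
      exists2 x0, interior (dom u) x0 & (u x0 < +oo)%E)
    (hgrowth : bounded_above U \/ dual_growth_condition U) :
  asymptotically_satiable U /\
  asymptotically_satiable (value_function P T F Pi (utility_extension hdD U)).
Proof.
have hD : (0 < D)%N by exact: leq_trans (hdD).
have bUt := borel_measurable_utility_extension hdD hU_borel.
have Utoo := utility_extension_lty hdD hU.
set Ut := utility_extension hdD U in hfin bUt Utoo *.
set u := value_function P T F Pi Ut in hfin *.
have cu : concave u.
  apply: value_function_concave => // l x y; exact: utility_extension_concave.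
have iu : cone_increasing orthant u.
  apply: value_function_increasing => //; exact: utility_extension_increasing.
have cU : concave U by case: hU => -[].
have Uoo x : (U x < +oo)%E by case: hU => -[].
have iU : cone_increasing orthant U by case: hU; rewrite hU_supp.
(* For [u] an interior point of finite value is given by [hfin]; for [U] the vector 1 serves. *)
have U1 : interior (dom U) (const_mx 1).
  apply: interior_pos => [i|x x0]; first by rewrite mxE.
  exact: utility_dom_pos.
have [x0 x0u ux0] := hfin.
case: hgrowth => [bU|gU].
  split; apply: bounded_asymptotically_satiable => //.
  - by exists (const_mx 1); exact: interior_subset U1.
  - by exists x0; exact: interior_subset x0u.
  - apply: value_function_bounded => //; case: bU => M UM; exists M => x.
    by rewrite /Ut /utility_extension; case: asboolP => // _; rewrite leNye.
split; [apply: (growth_asymptotically_satiable cU iU U1)|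
  apply: (growth_asymptotically_satiable cu iu x0u)] => // eps /[dup] /andP[e0 _] eps01;
  have [l [k [l0 lk]]] := primal_growth hU hU_supp gU eps01; exists l, k, (const_mx 1).
  by [].
split=> //; apply: value_function_affine => //; first exact: mulr_gt0.
by apply: utility_extension_growth => //; exact: mulr_gt0.
Qed.
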